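(* Let $\alpha,\beta>0$ and $d\in\{1,2,3,\ldots\}$. There exists a sequence of estimators $(V_n)_{n=1}^\infty$ with values in $\mathcal{D}_d$, where $V_n$ is a function of $X_1,\ldots,X_n$ not depending on the sampling density, such that both of the following hold. (i) (Universal consistency on $\mathcal{D}_d$.) For every fixed $p\in\mathcal{D}_d$, if $X_1,X_2,\ldots$ are i.i.d. with density $p$, then $\|p-V_n\|_1\to0$ in probability as $n\to\infty$. (ii) For every fixed sampling density $p\in\mathcal{D}_d\cap\mathfrak{V}(W,L)$, where $\mathfrak{V}(W,L)$ is an NL-class with $W_k\in O(k^{-\alpha})$ and $L_k\in O(k^{\beta})$ as $k\to\infty$, if $X_1,X_2,\ldots$ are i.i.d. with density $p$, then $$\|V_n-p\|_1\in\tilde{O}_n\left(n^{-\alpha/(3\alpha+\beta+1)}\right),$$ in the sense that there exist constants $C,c\ge 0$ such that $P\left(\|V_n-p\|_1\le C\,n^{-\alpha/(3\alpha+\beta+1)}(\log n)^c\right)\to1$ as $n\to\infty$.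
   Context: A pdf on $\mathbb{R}^d$ is an a.e. non-negative function on $\mathbb{R}^d$ with Lebesgue integral equal to one; equalities of functions mean equality Lebesgue-a.e. $\mathcal{D}_d$ is the set of all pdfs whose support is contained in the unit cube $[0,1]^d$. $\|\cdot\|_1$ is the $L^1$ norm with respect to Lebesgue measure. An estimator in $\mathcal{D}_d$ is a (measurable) map from samples $(X_1,\ldots,X_n)$ to $\mathcal{D}_d$. For functions $f_1,\ldots,f_d:\mathbb{R}\to\mathbb{R}$, $\prod_{j=1}^d f_j$ denotes $(x_1,\ldots,x_d)\mapsto f_1(x_1)\cdots f_d(x_d)$. Definition (NL-spectrum). A pdf $p$ on $\mathbb{R}^d$ has a non-negative Lipschitz spectrum (NL-spectrum) $(w,\ell)$, with $w=(w_i)_{i=1}^\infty$ and $\ell=(\ell_i)_{i=1}^\infty$, if $$p=\sum_{i=1}^\infty w_i\prod_{j=1}^d p_{i,j},$$ where $(w_i)_{i=1}^\infty$ is a non-negative sequence with $\sum_{i=1}^\infty w_i=1$ and $w_1>0$, and the $p_{i,j}$ ($i\ge1$, $1\le j\le d$) are Lipschitz continuous pdfs on $\mathbb{R}$ with Lipschitz constant $\ell_i$, i.e. $|p_{i,j}(x)-p_{i,j}(y)|\le \ell_i|x-y|$ for all $x,y\in\mathbb{R}$. Definition (NL-class). Let $W=(W_i)_{i=1}^\infty$ be a non-negative, non-increasing sequence converging to $0$ and let $L=(L_i)_{i=1}^\infty$ be a non-negative, non-decreasing sequence. The NL-class $\mathfrak{V}(W,L)$ is the set of all pdfs having an NL-spectrum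 $(w,\ell)$ that satisfies $\ell_k\le L_k$ and $\sum_{i=k+1}^\infty w_i\le W_k$ for all $k\ge 1$. *)

(* Defs.v *)
From HB Require Import structures.
From mathcomp Require Import all_boot all_order all_algebra finmap.
From mathcomp Require Import all_classical all_reals all_analysis.

Set Implicit Arguments.
Unset Strict Implicit.
Unset Printing Implicit Defensive.

Import Order.TTheory GRing.Theory Num.Theory.
Import numFieldNormedType.Exports.

Local Open Scope classical_set_scope.
Local Open Scope ring_scope.

(* R^d is modelled by d-tuples with the product (Borel) sigma-algebra. The
   library has binary product measures only: the d-fold power of a sigma-finite
   measure [m] is obtained by iterating [\x] and transporting along [cons],
   starting from the unit mass on 0-tuples; [tuple_measure_box] and
   [lebesgue_Rd_box] check its values on boxes. Sigma-finiteness is needed at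
   each step for the next product to be a measure. *)
Section consM.
Context disp (T : measurableType disp) (R : realType) (n : nat).

Definition consM (z : T * n.-tuple T) : n.+1.-tuple T := [tuple of z.1 :: z.2].

Lemma measurable_consM : measurable_fun [set: _] consM.
Proof. exact: (measurable_cons measurable_fst measurable_snd). Qed.

Definition unconsM (t : n.+1.-tuple T) : T * n.-tuple T :=
  (thead t, [tuple of behead t]).

Lemma consMK : cancel consM unconsM.
Proof. by case=> x t; congr pair; apply/val_inj. Qed.

Lemma measurable_unconsM : measurable_fun [set: _] unconsM.
Proof.
apply/measurable_fun_pair; [exact: measurable_tnth|exact: measurable_behead].
Qed.

Variable m : {sigma_finite_measure set T -> \bar R}.
Variable mu : {sigma_finite_measure set (n.-tuple T) -> \bar R}.

Definition cons_measure : set (n.+1.-tuple T) -> \bar R :=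
  pushforward (m \x mu)%E consM.

Let cons_measure0 : cons_measure set0 = 0%E.
Proof. by rewrite /cons_measure /pushforward preimage_set0 measure0. Qed.

Let cons_measure_ge0 A : (0 <= cons_measure A)%E.
Proof. exact: (measure_ge0 (m \x mu)%E). Qed.

Let cons_measure_sigma_additive : semi_sigma_additive cons_measure.
Proof.
move=> F mF tF mUF; rewrite /cons_measure /pushforward preimage_bigcup.
apply: measure_semi_sigma_additive.
- by move=> i; rewrite -[X in measurable X]setTI; exact: measurable_consM.
- apply/trivIsetP => /= i j _ _ ij; rewrite -preimage_setI.
  by move/trivIsetP : tF => /(_ _ _ _ _ ij) ->//; rewrite preimage_set0.
- rewrite -preimage_bigcup -[X in measurable X]setTI.
  exact: measurable_consM.
Qed.

HB.instance Definition _ := isMeasure.Build _ _ _ cons_measure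
  cons_measure0 cons_measure_ge0 cons_measure_sigma_additive.

Let sigma_finite_cons_measure : sigma_finite setT cons_measure.
Proof.
have /sigma_finiteP[F [TF ndF Foo]] := sigma_finiteT m.
have /sigma_finiteP[G [TG ndG Goo]] := sigma_finiteT mu.
exists (fun k => unconsM @^-1` (F k `*` G k)).
  rewrite -preimage_bigcup (_ : \bigcup_k _ = setT) ?preimage_setT//.
  rewrite -subTset => -[x t] _.
  have [i _ Fix] : (\bigcup_k F k) x by rewrite -TF.
  have [j _ Gjt] : (\bigcup_k G k) t by rewrite -TG.
  exists (maxn i j) => //; split.
  - by move: x Fix; exact/subsetPset/ndF/leq_maxl.
  - by move: t Gjt; exact/subsetPset/ndG/leq_maxr.
move=> k; have [mF Fk] := Foo k; have [mG Gk] := Goo k; split.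
  rewrite -[X in measurable X]setTI; apply: measurable_unconsM => //.
  exact: measurableX.
rewrite /cons_measure /pushforward -comp_preimage.
rewrite (_ : unconsM \o consM = id) ?preimage_id; last exact/funext/consMK.
by rewrite product_measure1E// lte_mul_pinfty// ge0_fin_numE.
Qed.

HB.instance Definition _ := Measure_isSigmaFinite.Build _ _ _ cons_measure
  sigma_finite_cons_measure.

End consM.

Fixpoint tuple_measure disp (T : measurableType disp) (R : realType)
    (m : {sigma_finite_measure set T -> \bar R}) (d : nat) :
    {sigma_finite_measure set (d.-tuple T) -> \bar R} :=
  match d with
  | 0 => dirac [tuple]
  | n.+1 => cons_measure m (tuple_measure m n)
  end.

Lemma tuple_measure_box disp (T : measurableType disp) (R : realType)
    (m : {sigma_finite_measure set T -> \bar R}) (d : nat) (A : 'I_d -> set T) :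
  (forall j, measurable (A j)) ->
  tuple_measure m d [set x | forall j, A j (tnth x j)] = (\prod_(j < d) m (A j))%E.
Proof.
elim: d A => [|d IHd] A mA.
  by rewrite big_ord0 /= diracE mem_set// => -[].
have mAS : measurable [set x : d.-tuple T | forall j, A (lift ord0 j) (tnth x j)].
  rewrite (_ : [set _ | _] =
      \bigcap_(j in [set: 'I_d]) ((@tnth _ T)^~ j @^-1` A (lift ord0 j))).
    apply: fin_bigcap_measurable => // j _.
    by rewrite -[X in measurable X]setTI; exact: measurable_tnth.
  by apply/seteqP; split => x /= Ax j; [move=> _|]; exact: Ax.
rewrite big_ord_recl /= -IHd// -product_measure1E//.
rewrite /cons_measure /pushforward; congr (product_measure1 _ _ _).
apply/seteqP; split => [[x t] /= Axt|[x t] [/= Ax At] j].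
  split; first exact: (Axt ord0).
  by move=> j; have := Axt (lift ord0 j); rewrite tnthS.
have [k ->|->] := unliftP ord0 j; last exact: Ax.
by rewrite tnthS; exact: At.
Qed.

Notation Rd R d := (d.-tuple (measurableTypeR R)).

Definition lebesgue_Rd (R : realType) (d : nat) :
    {sigma_finite_measure set (Rd R d) -> \bar R} :=
  tuple_measure (@lebesgue_measure R) d.

Lemma lebesgue_Rd_box (R : realType) (d : nat) (a b : 'I_d -> R) :
  (forall j, a j <= b j) ->
  lebesgue_Rd R d [set x | forall j, `[a j, b j]%classic (tnth x j)] =
  (\prod_(j < d) (b j - a j))%:E.
Proof.
move=> ab; apply: (etrans (tuple_measure_box (@lebesgue_measure R)
  (A := fun j => `[a j, b j]%classic : set (measurableTypeR R)) _)).
  by move=> j; exact: measurable_itv.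
rewrite -prodEFin; apply: eq_bigr => j _.
rewrite [LHS](lebesgue_measure_itv `[a j, b j]) /= lte_fin -EFinB.
by have := ab j; rewrite le_eqVlt => /predU1P[->|->//]; rewrite ltxx subrr.
Qed.

(* Borel measurability loses no generality: every Lebesgue-measurable function
   is a.e. equal to a Borel one. *)
Definition is_pdf disp (T : measurableType disp) (R : realType)
    (mu : {measure set T -> \bar R}) (f : T -> R) : Prop :=
  [/\ measurable_fun [set: T] f,
      {ae mu, forall x, 0 <= f x} &
      (\int[mu]_x (f x)%:E = 1)%E].

Definition unit_cube (R : realType) (d : nat) : set (Rd R d) :=
  [set x | forall j, 0 <= tnth x j <= 1].

(* Densities are functions up to a.e. equality, so the support condition is
   that [p] vanishes a.e. outside the (closed) cube. *)
Definition cube_pdf (R : realType) (d : nat) : set (Rd R d -> R) :=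
  [set p | is_pdf (lebesgue_Rd R d) p /\
           {ae lebesgue_Rd R d, forall x, ~ unit_cube x -> p x = 0}].

(* Sequences indexed from 1 in the mathematics are indexed from 0 here: [w k],
   [l k], [W k] and [L k] stand for w_(k+1), l_(k+1), W_(k+1) and L_(k+1); in
   particular [\sum_(k.+1 <= i <oo) w i] is the tail starting at w_(k+2). *)
Definition has_NL_spectrum (R : realType) (d : nat) (p : Rd R d -> R)
    (w l : R^nat) : Prop :=
  [/\ forall i, 0 <= w i,
      (\sum_(0 <= i <oo) (w i)%:E = 1)%E,
      0 < w 0 &
      exists q : nat -> 'I_d -> R -> R,
        [/\ forall i j, is_pdf (@lebesgue_measure R) (q i j),
            forall i j, (l i).-lipschitz (q i j) &
            {ae lebesgue_Rd R d, forall x, (p x)%:E =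
              (\sum_(0 <= i <oo) (w i * \prod_(j < d) q i j (tnth x j))%:E)%E}]].

Definition NL_bounds (R : realType) (W L : R^nat) : Prop :=
  [/\ forall k, 0 <= W k, nonincreasing_seq W, W @ \oo --> 0,
      forall k, 0 <= L k & nondecreasing_seq L].

Definition NL_class (R : realType) (d : nat) (W L : R^nat) :
    set (Rd R d -> R) :=
  [set p | is_pdf (lebesgue_Rd R d) p /\
    exists w l : R^nat, [/\ has_NL_spectrum p w l, forall k, l k <= L k &
      forall k, (\sum_(k.+1 <= i <oo) (w i)%:E <= (W k)%:E)%E]].

(* Measurability of the L^1-valued map is expressed by joint Borel measurability
   in the sample and the point: up to the choice of a version the two notions
   coincide, L^1 being separable. *)
Definition is_estimator (R : realType) (d n : nat)
    (V : n.-tuple (Rd R d) -> Rd R d -> R) : Prop :=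
  measurable_fun [set: n.-tuple (Rd R d) * Rd R d] (fun z => V z.1 z.2) /\
  forall s, cube_pdf (V s).

Definition mutually_independent disp disp' (Omega : measurableType disp)
    (T : measurableType disp') (R : realType) (P : probability Omega R)
    (X : nat -> {RV P >-> T}) : Prop :=
  forall (J : {fset nat}) (A : nat -> set T), (forall i, measurable (A i)) ->
    P (\bigcap_(i in [set` J]) (X i @^-1` A i)) =
    (\prod_(i <- J) P (X i @^-1` A i))%E.

Definition iid_with_density disp (Omega : measurableType disp) (R : realType)
    (d : nat) (P : probability Omega R) (X : nat -> {RV P >-> Rd R d})
    (p : Rd R d -> R) : Prop :=
  mutually_independent X /\
  forall i A, measurable A ->
    distribution P (X i) A = (\int[lebesgue_Rd R d]_(x in A) (p x)%:E)%E.

(* [X] is indexed from 0, so the sample of size n is X_0, ..., X_(n-1). *)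
Definition sample disp (Omega : measurableType disp) (R : realType) (d : nat)
    (P : probability Omega R) (X : nat -> {RV P >-> Rd R d}) (n : nat)
    (omega : Omega) : n.-tuple (Rd R d) :=
  [tuple X i omega | i < n].

Definition L1_dist (R : realType) (d : nat) (f g : Rd R d -> R) : \bar R :=
  ('N[lebesgue_Rd R d]_1[EFin \o (f \- g)%R])%E.

(* Main.v *)
(* The estimator is a minimum-distance estimator in the sense of Yatracos over
   a finite family F_n of densities on the cube. For every member f of F_n its
   risk is at most 5 |f - p|_1 + 4 t off an event which, by a Chernoff bound over
   the card(F_n)^2 comparison sets {f_j < f_i}, has probability at most
   2 card(F_n)^2 exp(- n t^2 / 8).
   F_n consists of the first n + 1 terms of a sequence that is L^1-dense in
   D_d, which gives universal consistency, and of all mixtures of k products of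
   step functions with b bins whose coefficients are multiples of 1/n. A density
   in the NL-class is within O(W_k + L_k / b + k / n) of such a mixture, and
   log card(F_n) = O(k b log n). With gamma = 1 / (3 alpha + beta + 1),
   k ~ n^gamma and b ~ n^(gamma (alpha + beta)), the approximation error and
   sqrt(log card(F_n) / n) are both of order n^(- alpha gamma) up to logarithms. *)

Require Import Defs.
From HB Require Import structures.
From mathcomp Require Import all_boot all_order all_algebra finmap.
From mathcomp Require Import all_classical all_reals all_analysis.
From mathcomp Require Import measurable_realfun.
From mathcomp Require Import ring lra.

Set Implicit Arguments.
Unset Strict Implicit.
Unset Printing Implicit Defensive.

Import Order.TTheory GRing.Theory Num.Theory.
Import numFieldNormedType.Exports.

Local Open Scope classical_set_scope.
Local Open Scope ring_scope.

(** * Chernoff bounds for empirical frequencies *)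

(** The estimator may use neither [W], [L] nor the constants hidden in their O-bounds, so the finite
    family is built from [n], [d], [alpha] and [beta] alone. Numerators run up to n^2, so that
    coefficients reach n: for k ~ n^gamma the Lipschitz constants L_k are of order n^(gamma beta)
    with gamma beta < 1, so every class is eventually accommodated, while the larger range costs
    only a constant factor in log card(F_n).

    The coded mixtures are not densities, and no constraint of total mass is imposed on their
    weights and step heights, which can therefore be rounded one by one. Truncating and normalizing
    them afterwards costs a factor 2 in the distance to any density on the cube. The same
    normalization turns an L^1-dense countable algebra of functions into a dense sequence of
    densities.

    The components of a mixture may charge the complement of the cube even though the mixture does
    not. All comparisons with codes are therefore made on the cube, where a component factor has
    integral at most 1 over [0, 1]. *)

Section Chernoff.
Context disp disp' (Omega : measurableType disp) (T : measurableType disp').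
Context (R : realType) (P : probability Omega R) (X : nat -> {RV P >-> T}).

Lemma measurable_RV_preimage i (A : set T) :
  measurable A -> measurable (X i @^-1` A).
Proof. by move=> mA; rewrite -[_ @^-1` _]setTI; exact: measurable_funPT. Qed.

Lemma measurable_hits n (A : set T) : measurable A ->
  measurable_fun [set: Omega] (fun w => \sum_(i < n) \1_A (X i w) : R).
Proof.
move=> mA; apply: measurable_sum => i.
by apply: measurableT_comp; [exact: measurable_indic|exact: measurable_funPT].
Qed.

(* Expanding the product over the subsets of the sample reduces this to the
   product rule for finite intersections. *)
Lemma integral_prod_indic n (s q : R) (A : set T) : measurable A -> 0 <= s ->
  mutually_independent X -> (forall i, P (X i @^-1` A) = q%:E) ->
  (\int[P]_w (\prod_(i < n) (1 + s * \1_A (X i w)))%:E =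
   ((1 + s * q) ^+ n)%:E)%E.
Proof.
move=> mA s0 indX PA.
(* Independence is stated for finite sets of naturals, hence the image of [J] under [val]. *)
pose I (J : {set 'I_n}) : set Omega :=
  \bigcap_(i in [set` [fset (val i) | i in J]%fset]) (X i @^-1` A).
have mI J : measurable (I J).
  by apply: bigcap_measurableType => i _; exact: measurable_RV_preimage.
have PI J : P (I J) = (q ^+ #|J|)%:E.
  rewrite /I indX// big_imfset/=; last by move=> i j _ _; exact: val_inj.
  rewrite (eq_bigr (fun=> q%:E)); last by move=> i _; exact: PA.
  rewrite prodEFin; congr (_%:E).
  by rewrite big_enum prodr_const.
transitivity (\int[P]_w (\sum_(J : {set 'I_n}) (s ^+ #|J| * \1_(I J) w)%:E))%E.
  apply: eq_integral => w _; rewrite sumEFin; congr (_%:E).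
  under eq_bigr do rewrite addrC.
  rewrite bigA_distr; apply: eq_bigr => J _.
  rewrite -big_mkcond/= big_split/= prodr_const; congr (_ * _).
  rewrite indicE; have [wI|wI] := boolP (w \in I J).
    rewrite big1// => i iJ; rewrite indicE mem_set//.
    move: wI; rewrite inE => /(_ (val i)); apply => /=.
    by apply/imfsetP; exists i.
  move: wI; rewrite notin_setE => /existsNP[i] /not_implyP[/=].
  move=> /imfsetP[/= j jJ ->] XjA; rewrite (bigD1 j)//= indicE memNset//.
  by rewrite mul0r.
rewrite ge0_integral_sum//=; last 2 first.
- move=> J; apply/measurable_EFinP; apply: measurable_funM => //.
- by move=> J w _; rewrite lee_fin mulr_ge0// exprn_ge0.
rewrite (eq_bigr (fun J : {set 'I_n} => ((s * q) ^+ #|J|)%:E)); last first.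
  move=> J _; under eq_integral do rewrite EFinM.
  rewrite ge0_integralZl//=; last 2 first.
  - by apply/measurable_EFinP; exact: measurable_indic.
  - by rewrite lee_fin exprn_ge0.
  rewrite integral_indic// setIT (_ : _ (I J) = (q ^+ #|J|)%:E); last exact: PI.
  by rewrite -EFinM exprMn.
rewrite sumEFin; congr (_%:E).
rewrite -[X in _ ^+ X]card_ord -prodr_const addrC bigA_distr.
apply: eq_bigr => J _; rewrite -big_mkcond/= prodr_const//.
Qed.

(** From exp(-x) >= 1 - x one gets (1 - x) exp(x) <= 1, while (1 - x)(1 + x + 2 x^2) = 1 + x^2 (1 -
    2 x) >= 1. *)
Lemma expR_le_quadratic (x : R) : 0 <= x -> x <= 2^-1 -> expR x <= 1 + x + 2 * x ^+ 2.
Proof.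
move=> x0 x2; have := expR_ge1Dx (- x); rewrite expRN => h.
have e0 := expR_gt0 x.
have : (1 - x) * expR x <= 1.
  by rewrite -ler_pdivlMr// div1r.
have : 1 <= (1 - x) * (1 + x + 2 * x ^+ 2) by nra.
move=> h1 h2; have x1 : 0 < 1 - x by lra.
by rewrite -(ler_pM2l x1) (le_trans h2).
Qed.

(** Exponential Markov inequality with parameter t/4. With s = exp(t/4) - 1 each factor exp(t/4 1_A)
    equals 1 + s 1_A, so the moment is (1 + s q)^n <= exp(n s q). As t/4 <= 1/2, s <= t/4 + t^2/8,
    and q <= 1 leaves the exponent n (t^2/8 - t^2/4). *)
Lemma chernoff_hits n (q t : R) (A : set T) : measurable A ->
  mutually_independent X -> (forall i, P (X i @^-1` A) = q%:E) ->
  0 < t -> t <= 2 ->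
  (P [set w | n%:R * (q + t) <= \sum_(i < n) \1_A (X i w)]%R <=
   (expR (- (n%:R * t ^+ 2 / 8)))%:E)%E.
Proof.
move=> mA indX PA t0 t2; set E := [set w | _].
have mE : measurable E.
  rewrite -[E]setTI; apply: measurable_fun_le => //.
  exact: measurable_hits.
have q0 : 0 <= q by rewrite -lee_fin -(PA 0).
have q1 : q <= 1 by rewrite -lee_fin -(PA 0); exact: probability_le1
  (measurable_RV_preimage _ _).
pose s := expR (t / 4) - 1.
have s0 : 0 <= s.
  by have := expR_ge1Dx (t / 4); rewrite /s; lra.
pose K := expR (t / 4 * (n%:R * (q + t))).
have K0 : 0 < K := expR_gt0 _.
have KP : (K%:E * P E <= ((1 + s * q) ^+ n)%:E)%E.
  rewrite -(integral_prod_indic n mA s0 indX PA).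
  rewrite -{1}[E]setIT -(integral_indic P measurableT mE).
  rewrite -ge0_integralZl//; last 2 first.
  - by apply/measurable_EFinP; exact: measurable_indic.
  - by rewrite lee_fin ltW.
  apply: ge0_le_integral => //.
  - by move=> w _; rewrite -EFinM lee_fin mulr_ge0// ltW.
  - apply/measurable_EFinP; apply: measurable_funM => //.
  - apply/measurable_EFinP; apply: measurable_prod => i _.
    apply: measurable_funD => //; apply: measurable_funM => //.
    apply: measurableT_comp; last exact: measurable_funPT.
    exact: measurable_indic.
  move=> w _; rewrite -EFinM lee_fin.
  have prodE : \prod_(i < n) (1 + s * \1_A (X i w)) =
      expR (t / 4 * \sum_(i < n) \1_A (X i w)).
    rewrite mulr_sumr expR_sum; apply: eq_bigr => i _.
    rewrite indicE; case: (_ \in _); last by rewrite !mulr0 addr0 expR0.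
    by rewrite !mulr1 /s addrC subrK.
  rewrite prodE [X in _ * X]indicE.
  have [wE|wE] := boolP (w \in E); last by rewrite mulr0 expR_ge0.
  by rewrite mulr1 ler_expR ler_wpM2l//; [lra|exact: (set_mem wE)].
have PE : (P E <= (K^-1 * (1 + s * q) ^+ n)%:E)%E.
  by rewrite EFinM lee_pdivlMl.
apply: le_trans PE _; rewrite lee_fin.
apply: (@le_trans _ _ (K^-1 * expR (n%:R * (s * q)))).
  apply: ler_wpM2l; first by rewrite invr_ge0 ltW.
  rewrite [n%:R * _]mulrC expRM_natr.
  by rewrite lerXn2r ?nnegrE ?expR_ge0 ?expR_ge1Dx// addr_ge0// mulr_ge0.
rewrite /K -expRN -expRD ler_expR.
have sle : s <= t / 4 + 2 * (t / 4) ^+ 2.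
  by have := @expR_le_quadratic (t / 4); rewrite /s; lra.
have sq : s * q - t / 4 * (q + t) + t ^+ 2 / 8 <= 0.
  have : s * q <= t / 4 * q + 2 * (t / 4) ^+ 2 by nra.
  by rewrite expr2; lra.
have := mulr_ge0_le0 (ler0n R n) sq; lra.
Qed.

Lemma measurable_hits_deviation n (q t : R) (A : set T) : measurable A ->
  measurable [set w | t <= `|(\sum_(i < n) \1_A (X i w)) / n%:R - q|].
Proof.
move=> mA; rewrite -[X in measurable X]setTI.
apply: measurable_fun_le => //; apply: measurableT_comp => //.
apply: measurable_funB => //; apply: measurable_funM => //.
exact: measurable_hits.
Qed.

(** The lower tail for [A] is the upper tail for its complement, of probability 1 - q; hence the
    factor 2. *)
Lemma hits_deviation n (q t : R) (A : set T) : measurable A -> (0 < n)%N ->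
  mutually_independent X -> (forall i, P (X i @^-1` A) = q%:E) ->
  0 < t -> t <= 2 ->
  (P [set w | t <= `|(\sum_(i < n) \1_A (X i w)) / n%:R - q|]%R <=
   (2 * expR (- (n%:R * t ^+ 2 / 8)))%:E)%E.
Proof.
move=> mA n0 indX PA t0 t2; have n0' : 0 < n%:R :> R by rewrite ltr0n.
have mAC : measurable (~` A) by exact: measurableC.
have PAC i : P (X i @^-1` (~` A)) = (1 - q)%:E.
  rewrite preimage_setC probability_setC; last exact: measurable_RV_preimage.
  by rewrite PA EFinB.
set E := fun (B : set T) (r : R) =>
  [set w | n%:R * (r + t) <= \sum_(i < n) \1_B (X i w)] : set Omega.
have mE B r : measurable B -> measurable (E B r).
  move=> mB; rewrite -[E B r]setTI.
  by apply: measurable_fun_le => //; exact: measurable_hits.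
have le_E : (P (E A q `|` E (~` A) (1 - q)%R) <=
    (2 * expR (- (n%:R * t ^+ 2 / 8)))%:E)%E.
  have := measureU2 P (mE A q mA) (mE _ (1 - q)%R mAC); move=> /le_trans; apply.
  rewrite mulr_natl mulr2n EFinD; apply: leeD.
    exact: chernoff_hits.
  exact: chernoff_hits.
apply: le_trans le_E; apply: le_measure; rewrite ?inE.
- exact: measurable_hits_deviation.
- by apply: measurableU; exact: mE.
move=> w /=; rewrite ler_normr => /orP[h|h]; [left|right]; rewrite /E/=.
  by rewrite mulrC -ler_pdivlMr// addrC -lerBrDr.
have -> : \sum_(i < n) \1_(~` A) (X i w) = n%:R - \sum_(i < n) \1_A (X i w) :> R.
  have -> : n%:R = \sum_(i < n) 1 :> R by rewrite sumr_const card_ord.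
  rewrite -sumrB.
  apply: eq_bigr => i _; rewrite !indicE in_setC.
  by case: (_ \in A); rewrite ?subrr ?subr0.
have := h; rewrite -(ler_pM2l n0') mulrN mulrBr mulrC [n%:R * (_ / _)]mulrC
  mulfVK ?gt_eqF//.
lra.
Qed.

End Chernoff.

(** * Minimum-distance selection *)

Section L1distance.
Context d (T : measurableType d) (R : realType) (mu : {measure set T -> \bar R}).
Implicit Types f g h : T -> R.

Local Notation integrable f := (mu.-integrable [set: T] (EFin \o f)).

Lemma measurable_lt_set f g : measurable_fun [set: T] f ->
  measurable_fun [set: T] g -> measurable [set x | f x < g x].
Proof.
move=> mf mg; rewrite (_ : [set x | _] = ~` [set x | g x <= f x]).
  by apply: measurableC; rewrite -[X in measurable X]setTI; exact: measurable_fun_le.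
by apply/seteqP; split => x /=; rewrite ltNge => /negP.
Qed.

Lemma rintegrableD f g (D : set T) : measurable D ->
  mu.-integrable D (EFin \o f) -> mu.-integrable D (EFin \o g) ->
  mu.-integrable D (EFin \o (f \+ g)).
Proof. by move=> mD intf intg; have := integrableD mD intf intg. Qed.

Lemma rintegrableB f g (D : set T) : measurable D ->
  mu.-integrable D (EFin \o f) -> mu.-integrable D (EFin \o g) ->
  mu.-integrable D (EFin \o (f \- g)).
Proof. by move=> mD intf intg; have := integrableB mD intf intg. Qed.

Lemma integrable_dist f g (D : set T) : measurable D ->
  mu.-integrable D (EFin \o f) -> mu.-integrable D (EFin \o g) ->
  mu.-integrable D (EFin \o (fun x => `|f x - g x|)).
Proof.
by move=> mD intf intg; exact: integrable_norm (rintegrableB mD intf intg).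
Qed.

(** Real-valued, so that linear arithmetic applies, and relative to [D], which will be either the
    whole space or the cube. *)
Definition dist1 (D : set T) f g : R := \int[mu]_(x in D) `|f x - g x|.

Lemma dist1_ge0 D f g : 0 <= dist1 D f g.
Proof. by apply: Rintegral_ge0. Qed.

Lemma dist1C D f g : dist1 D f g = dist1 D g f.
Proof. by apply: eq_Rintegral => x _; rewrite distrC. Qed.

Lemma dist1_triangle D f g h : measurable D -> mu.-integrable D (EFin \o f) ->
  mu.-integrable D (EFin \o g) -> mu.-integrable D (EFin \o h) ->
  dist1 D f h <= dist1 D f g + dist1 D g h.
Proof.
move=> mD intf intg inth; rewrite /dist1 -RintegralD//; [|exact: integrable_dist..].
apply: le_Rintegral => //; first exact: integrable_dist.
  by apply: rintegrableD => //; exact: integrable_dist.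
by move=> x _; exact: ler_distD.
Qed.

Lemma dist1_set f g (A : set T) : measurable A -> integrable f -> integrable g ->
  `|\int[mu]_(x in A) f x - \int[mu]_(x in A) g x| <= dist1 setT f g.
Proof.
move=> mA intf intg.
have intA h : integrable h -> mu.-integrable A (EFin \o h).
  by move=> inth; apply: integrableS inth.
rewrite -RintegralB//; [|exact: intA..].
apply: (le_trans (le_normr_Rintegral _ _)) => //.
  by apply: rintegrableB => //; exact: intA.
rewrite Rintegral_mkcond /dist1; apply: le_Rintegral => //.
- rewrite [X in mu.-integrable _ X](_ : _ = (EFin \o (fun x => `|f x - g x|)) \_ A).
    by have /(integrable_mkcond _ mA) := intA _ (integrable_dist measurableT intf
      intg).
  by apply/funext => x; rewrite /= !patchE; case: ifPn.
- exact: integrable_dist.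
- by move=> x _; rewrite patchE; case: ifPn => // _; exact: normr_ge0.
Qed.

(** Scheffé's identity: when the total masses agree, the positive and negative parts of f - g have
    the same integral. *)
Lemma dist1_eq_integral f g : integrable f -> integrable g ->
  \int[mu]_x f x = \int[mu]_x g x ->
  dist1 setT f g = 2 * (\int[mu]_(x in [set x | g x < f x]) f x -
                   \int[mu]_(x in [set x | g x < f x]) g x).
Proof.
move=> intf intg fg; set A := [set x | _].
have mA : measurable A.
  apply: measurable_lt_set.
    by apply/measurable_EFinP; case/integrableP: intg.
  by apply/measurable_EFinP; case/integrableP: intf.
have intB h B : measurable B -> integrable h -> mu.-integrable B (EFin \o h).
  by move=> mB inth; apply: integrableS inth.
have split_int h : integrable h ->
    \int[mu]_x h x = \int[mu]_(x in A) h x + \int[mu]_(x in ~` A) h x.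
  move=> inth; rewrite -Rintegral_setU ?setUv//; first exact: measurableC.
  by apply/disj_set2P; rewrite setICr.
rewrite /dist1 split_int; last exact: integrable_dist.
have mAC := measurableC mA.
rewrite (@eq_Rintegral _ _ _ _ A (fun x => f x - g x)); last first.
  by move=> x; rewrite inE/= => gf; rewrite ger0_norm// subr_ge0 ltW.
rewrite (@eq_Rintegral _ _ _ _ (~` A) (fun x => g x - f x)); last first.
  move=> x; rewrite inE/= => /negP; rewrite -leNgt => fg'.
  by rewrite ler0_norm ?opprB// subr_le0.
rewrite !RintegralB//; [|exact: intB..].
move: fg; rewrite !split_int//; lra.
Qed.

End L1distance.

(** * Yatracos sets and the minimum-distance index *)

Section Yatracos.
Context d (T : measurableType d) (R : realType) (mu : {measure set T -> \bar R}).
Context (I : finType) (f : I -> T -> R).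

Local Notation integrable f := (mu.-integrable [set: T] (EFin \o f)).

Definition yatracos_set (jk : I * I) : set T := [set x | f jk.2 x < f jk.1 x].

(** [nu] is any set function, later the empirical measure. The base value 0 of the maximum agrees
    with the sign of the norms. *)
Definition discrepancy (nu : set T -> R) (i : I) : R :=
  \big[Num.max/0]_(jk : I * I)
    `|\int[mu]_(x in yatracos_set jk) f i x - nu (yatracos_set jk)|.

Lemma le_discrepancy nu i jk :
  `|\int[mu]_(x in yatracos_set jk) f i x - nu (yatracos_set jk)| <=
  discrepancy nu i.
Proof. exact: le_bigmax. Qed.

Hypothesis intf : forall i, integrable (f i).

Lemma measurable_yatracos_set jk : measurable (yatracos_set jk).
Proof.
by apply: measurable_lt_set; apply/measurable_EFinP;
  [case/integrableP: (intf jk.2)|case/integrableP: (intf jk.1)].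
Qed.

(** By Scheffé's identity the distance from f_s to f_i is twice a difference on one comparison set,
    hence at most 2 (disc(s) + disc(i)) <= 4 disc(i) <= 4 (|f_i - p|_1 + t). The triangle inequality
    through f_i adds one more |f_i - p|_1. *)
Lemma discrepancy_minimizer (p : T -> R) (nu : set T -> R) (t : R) (s i : I) :
  integrable p -> (forall i, \int[mu]_x f i x = \int[mu]_x p x) ->
  0 <= t ->
  (forall jk, `|nu (yatracos_set jk) - \int[mu]_(x in yatracos_set jk) p x| <= t) ->
  (forall j, discrepancy nu s <= discrepancy nu j) ->
  dist1 mu setT (f s) p <= 5 * dist1 mu setT (f i) p + 4 * t.
Proof.
move=> intp fp t0 nut smin.
have := dist1_triangle measurableT (intf s) (intf i) intp.
rewrite (dist1_eq_integral (intf s) (intf i)) ?fp// -/(yatracos_set (s, i)).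
have := le_discrepancy nu s (s, i); have := le_discrepancy nu i (s, i).
rewrite !ler_norml => /andP[h1 h2] /andP[h3 h4].
have disci : discrepancy nu i <= dist1 mu setT (f i) p + t.
  apply: bigmax_le => [|jk _]; first by rewrite addr_ge0// dist1_ge0.
  have /= := nut jk; rewrite distrC => ht.
  apply: le_trans (ler_distD (\int[mu]_(x in yatracos_set jk) p x) _ _) _.
  by rewrite lerD// dist1_set//; exact: measurable_yatracos_set.
have := smin i; lra.
Qed.

Variable i0 : I.

Definition yatracos_index (nu : set T -> R) : I :=
  odflt i0 [pick i | [forall j, discrepancy nu i <= discrepancy nu j]].

(** The finite type is inhabited by [i0], so a minimizer exists and the choice succeeds. *)
Lemma yatracos_indexP nu j :
  discrepancy nu (yatracos_index nu) <= discrepancy nu j.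
Proof.
rewrite /yatracos_index; case: pickP => [i /forallP|/=]; first exact.
case: (@Order.TotalTheory.arg_minP _ _ _ i0 predT (discrepancy nu)) => // i _ imin.
by move=> /(_ i) /forallP[]k; exact: imin.
Qed.

(** The index depends on [s] only through the finite Boolean table [b s] comparing discrepancies.
    The event is thus a finite union of finite intersections of comparison events, however [pick]
    breaks ties. *)
Lemma measurable_yatracos_index d' (S : measurableType d') (nu : S -> set T -> R) i :
  (forall A, measurable A -> measurable_fun [set: S] (nu ^~ A)) ->
  measurable [set s | yatracos_index (nu s) = i].
Proof.
move=> mnu.
pose b s : {ffun I * I -> bool} :=
  [ffun jk => discrepancy (nu s) jk.1 <= discrepancy (nu s) jk.2].
pose h (c : {ffun I * I -> bool}) := odflt i0 [pick i | [forall j, c (i, j)]].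
have hb s : yatracos_index (nu s) = h (b s).
  rewrite /yatracos_index /h; congr odflt; apply: eq_pick => j.
  by apply: eq_forallb => k; rewrite ffunE.
have mdisc j : measurable_fun [set: S] (fun s => discrepancy (nu s) j).
  rewrite /discrepancy; elim: (index_enum _) => [|jk r IHr].
    by under eq_fun do rewrite big_nil; exact: measurable_cst.
  under eq_fun do rewrite big_cons /=.
  apply: measurable_maxr => //; apply: measurableT_comp => //.
  by apply: measurable_funB => //; apply/mnu/measurable_yatracos_set.
rewrite (_ : [set s | _] = \bigcup_(c in [set c | h c = i])
    \bigcap_(jk in [set: I * I]) [set s | b s jk = c jk]).
  apply: fin_bigcup_measurable => [|c _]; first exact: finite_finset.
  apply: fin_bigcap_measurable => [|jk _]; first exact: finite_finset.
  have mb : measurable [set s | b s jk].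
    rewrite -[X in measurable X]setTI; under eq_set do rewrite ffunE.
    exact: measurable_fun_le.
  case: (c jk) => //; rewrite (_ : [set s | _] = ~` [set s | b s jk]).
    exact: measurableC.
  by apply/seteqP; split => s /=; [move=> ->|move=> /negP/negbTE].
apply/seteqP; split => s /=; rewrite hb.
  by move=> hi; exists (b s).
by move=> [c <-] bc; congr h; apply/ffunP => jk; exact: bc.
Qed.

End Yatracos.

(** * From the selected index to an estimator and its risk *)

Section Estimator.

Lemma is_pdf_abse d (T : measurableType d) (R : realType)
    (mu : {measure set T -> \bar R}) (f : T -> R) :
  is_pdf mu f -> (\int[mu]_x `|(f x)%:E| = 1)%E.
Proof.
move=> [mf f0 f1]; rewrite -f1; apply: ae_eq_integral => //.
- by apply: measurableT_comp => //; exact/measurable_EFinP.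
- exact/measurable_EFinP.
by apply: filterS f0 => x fx _ /=; rewrite ger0_norm.
Qed.

Lemma is_pdf_integrable d (T : measurableType d) (R : realType)
    (mu : {measure set T -> \bar R}) (f : T -> R) :
  is_pdf mu f -> mu.-integrable [set: T] (EFin \o f).
Proof.
move=> pdff; apply/integrableP; split; last by rewrite is_pdf_abse// ltry.
by apply/measurable_EFinP; case: pdff.
Qed.

Lemma dist1_pdf_le2 d (T : measurableType d) (R : realType)
    (mu : {measure set T -> \bar R}) (f g : T -> R) :
  is_pdf mu f -> is_pdf mu g -> dist1 mu setT f g <= 2.
Proof.
move=> pdff pdfg.
have int0 : mu.-integrable [set: T] (EFin \o cst 0) by exact: integrable0.
have := dist1_triangle measurableT (is_pdf_integrable pdff) int0
  (is_pdf_integrable pdfg).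
suff dist0 h : is_pdf mu h -> dist1 mu setT h (cst 0) = 1.
  by rewrite [X in _ + X]dist1C !dist0//; lra.
move=> pdfh; rewrite /dist1 /Rintegral.
by under eq_integral do rewrite subr0 -abse_EFin; rewrite is_pdf_abse.
Qed.

Lemma is_pdf_Rintegral d (T : measurableType d) (R : realType)
    (mu : {measure set T -> \bar R}) (f : T -> R) :
  is_pdf mu f -> \int[mu]_x f x = 1.
Proof. by case=> _ _ f1; rewrite /Rintegral f1. Qed.

Context (R : realType) (d : nat).
Local Notation mu := (lebesgue_Rd R d).

Lemma L1_distE (f g : Rd R d -> R) : mu.-integrable [set: _] (EFin \o f) ->
  mu.-integrable [set: _] (EFin \o g) -> L1_dist f g = (dist1 mu setT f g)%:E.
Proof.
move=> intf intg; rewrite /L1_dist Lnorm1 /dist1 /Rintegral fineK//.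
by apply: integrable_fin_num => //; exact: integrable_dist.
Qed.

Definition empirical n (s : n.-tuple (Rd R d)) (A : set (Rd R d)) : R :=
  (\sum_(i < n) \1_A (tnth s i)) / n%:R.

Lemma measurable_empirical n A : measurable A ->
  measurable_fun [set: n.-tuple (Rd R d)] (fun s => empirical s A).
Proof.
move=> mA; apply: measurable_funM => //; apply: measurable_sum => i.
by apply: measurableT_comp; [exact: measurable_indic|exact: measurable_tnth].
Qed.

Lemma measurable_sample disp (Omega : measurableType disp)
    (P : probability Omega R) (X : nat -> {RV P >-> Rd R d}) n :
  measurable_fun [set: Omega] (sample X n).
Proof.
apply/measurable_fun_tnthP => i; rewrite (_ : _ \o _ = X i).
  exact: measurable_funPT.
by apply/funext => w /=; rewrite tnth_mktuple.
Qed.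

(** The risk bound can fail only when the empirical measure deviates by at least t on one of the
    card(I)^2 comparison sets. The loss depends on the sample only through an index in a finite
    type, so every event about it is measurable, with no condition on [Q]; this is what later
    comparisons of events and passages to complements rely on. *)
Lemma yatracos_estimator (I : finType) (i0 : I) (f : I -> Rd R d -> R) n :
  (forall i, cube_pdf (f i)) ->
  exists V : n.-tuple (Rd R d) -> Rd R d -> R, is_estimator V /\
    forall p, cube_pdf p ->
    forall disp (Omega : measurableType disp) (P : probability Omega R)
      (X : nat -> {RV P >-> Rd R d}), iid_with_density X p ->
    (forall Q : set (\bar R),
       measurable [set w | Q (L1_dist (V (sample X n w)) p)]) /\
    forall (t : R) (i : I), (0 < n)%N -> 0 < t -> t <= 2 ->
      (P [set w | ~ (L1_dist (V (sample X n w)) p <=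
                     5%:E * L1_dist (f i) p + (4 * t)%:E)] <=
       ((#|I| ^ 2)%:R * (2 * expR (- (n%:R * t ^+ 2 / 8))))%:E)%E.
Proof.
move=> fpdf.
have intf i : mu.-integrable [set: _] (EFin \o f i).
  by apply: is_pdf_integrable; case: (fpdf i).
pose sel (s : n.-tuple (Rd R d)) := yatracos_index mu f i0 (empirical s).
have msel i : measurable [set s | sel s = i].
  apply: measurable_yatracos_index => //.
  by move=> A mA; exact: measurable_empirical.
exists (fun s => f (sel s)); split.
  split; last by move=> s; exact: fpdf.
  rewrite (_ : (fun z => _) = (fun z : n.-tuple (Rd R d) * Rd R d =>
      \sum_(i : I) \1_[set s | sel s = i] z.1 * f i z.2)); last first.
    apply/funext => z; rewrite (bigD1 (sel z.1))//= indicE mem_set// mul1r.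
    rewrite big1 ?addr0// => i isel; rewrite indicE memNset ?mul0r//=.
    by move=> seli; move: isel; rewrite seli eqxx.
  apply: measurable_sum => i; apply: measurable_funM.
    by apply: measurableT_comp; [exact: measurable_indic|exact: measurable_fst].
  apply: measurableT_comp; last exact: measurable_snd.
  by case: (fpdf i) => -[].
move=> p ppdf disp Omega P X [indX distX].
have intp : mu.-integrable [set: _] (EFin \o p).
  by apply: is_pdf_integrable; case: ppdf.
have mselX i : measurable [set w | sel (sample X n w) = i].
  rewrite -[X in measurable X]setTI.
  exact: (@measurable_sample _ _ _ X n measurableT _ (msel i)).
have mQ (Q : set (\bar R)) :
    measurable [set w | Q (L1_dist (f (sel (sample X n w))) p)].
  rewrite (_ : [set w | _] = \bigcup_(i in [set i | Q (L1_dist (f i) p)])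
      [set w | sel (sample X n w) = i]).
    by apply: fin_bigcup_measurable => // ; exact: finite_finset.
  apply/seteqP; split => w /=; first by move=> h; exists (sel (sample X n w)).
  by move=> [j Qj selj]; rewrite selj.
split=> // t i n0 t0 t2.
have mY jk : measurable (yatracos_set f jk) by exact: measurable_yatracos_set intf jk.
pose q jk := \int[mu]_(x in yatracos_set f jk) p x.
have PX jk j : P (X j @^-1` yatracos_set f jk) = (q jk)%:E.
  rewrite -[LHS]/(distribution P (X j) _) distX// /q /Rintegral fineK//.
  by apply: integrable_fin_num => //; exact: integrableS intp.
pose B jk := [set w | t <= `|(\sum_(j < n) \1_(yatracos_set f jk) (X j w)) / n%:R
  - q jk|].
have mB jk : measurable (B jk) by exact: measurable_hits_deviation.
apply: (@le_trans _ _ (\sum_(jk \in [set` enum {: I * I}]) P (B jk))%E).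
  apply: content_sub_fsum => //.
    exact: (mQ (fun y => ~ (y <= 5 * L1_dist (f i) p + (4 * t)%:E)%E)).
  move=> w /=; apply: contra_notP => wB.
  have wB' jk : `|empirical (sample X n w) (yatracos_set f jk) - q jk| <= t.
    rewrite leNgt; apply/negP => h; apply: wB; exists jk; rewrite /= ?mem_enum//.
    apply: ltW; congr (_ < `|_ / _ - _|): h.
    by apply: eq_bigr => j _; rewrite tnth_mktuple.
  rewrite !L1_distE// -EFinM -EFinD lee_fin.
  apply: (discrepancy_minimizer intf) => //.
  - by move=> j; rewrite !is_pdf_Rintegral//; [case: ppdf|case: (fpdf j)].
  - exact: ltW.
  - by move=> j; exact: yatracos_indexP.
rewrite -fsbig_seq ?enum_uniq//; apply: (@le_trans _ _
    (\sum_(jk <- enum {: I * I}) (2 * expR (- (n%:R * t ^+ 2 / 8)))%:E)%E).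
  by apply: lee_sum => jk _; exact: hits_deviation.
by rewrite sumEFin lee_fin big_enum sumr_const card_prod mulnn -[leLHS]mulr_natl.
Qed.

End Estimator.

(** * Densities on the cube *)

Section Normalization.
Context (R : realType) (d : nat).
Local Notation mu := (lebesgue_Rd R d).
Local Notation cube := (@unit_cube R d).

Lemma measurable_unit_cube : measurable cube.
Proof.
rewrite (_ : cube = \bigcap_(j in [set: 'I_d])
    (fun x : Rd R d => tnth x j) @^-1` `[0, 1]%classic).
  apply: fin_bigcap_measurable => [|j _]; first exact: finite_finset.
  rewrite -[X in measurable X]setTI.
  exact: (measurable_tnth j measurableT (measurable_itv `[0, 1])).
by apply/seteqP; split => x /= h j; [move=> _|]; have := h j; rewrite /=
  in_itv/=; [|apply].
Qed.

Lemma lebesgue_unit_cube : mu cube = 1%E.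
Proof.
have -> : cube = [set x | forall j, `[0, 1]%classic (tnth x j)].
  by apply/seteqP; split => x /= h j; have := h j; rewrite /= in_itv/=.
rewrite (@lebesgue_Rd_box R d (fun=> 0) (fun=> 1)) => [|j]; last exact: ler01.
by rewrite big1 // => j _; rewrite subr0.
Qed.

Lemma lebesgue_unit_cube_lty : (mu cube < +oo)%E.
Proof. by rewrite lebesgue_unit_cube ltry. Qed.

Lemma indic_cube_pdf : cube_pdf \1_cube.
Proof.
split; last by apply: nearW => x xC; rewrite indicE memNset.
split; [|exact: nearW|].
  by apply: measurable_indic; exact: measurable_unit_cube.
rewrite integral_indic ?setIT//; last exact: measurable_unit_cube.
exact: lebesgue_unit_cube.
Qed.

Definition truncate_cube (h : Rd R d -> R) (x : Rd R d) : R :=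
  Num.max (h x) 0 * \1_cube x.

(* The first branch is only there to return a density in the degenerate case. *)
Definition cube_density (h : Rd R d -> R) : Rd R d -> R :=
  let S := \int[mu]_x truncate_cube h x in
  if S == 0 then \1_cube else fun x => S^-1 * truncate_cube h x.

Lemma truncate_cube_ge0 h x : 0 <= truncate_cube h x.
Proof. by rewrite mulr_ge0// le_max lexx orbT. Qed.

Lemma integrable_truncate_cube h : mu.-integrable cube (EFin \o h) ->
  mu.-integrable [set: _] (EFin \o truncate_cube h).
Proof.
move=> inth; have mC := measurable_unit_cube.
have /(integrable_mkcond _ mC) := integrable_funrpos mC inth.
congr (integrable _ _ _); apply/funext => x; rewrite /= patchE /truncate_cube.
by rewrite indicE; case: ifPn => _; rewrite ?mulr1 ?mulr0.
Qed.

Lemma cube_density_pdf h : measurable_fun [set: _] h ->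
  mu.-integrable cube (EFin \o h) -> cube_pdf (cube_density h).
Proof.
move=> mh inth; have mC := measurable_unit_cube.
have intt := integrable_truncate_cube inth.
have mt : measurable_fun [set: _] (truncate_cube h).
  by apply/measurable_EFinP; case/integrableP: intt.
rewrite /cube_density; have [S0|S0] := eqVneq; first exact: indic_cube_pdf.
split.
- have Sge0 : 0 <= \int[mu]_x truncate_cube h x.
    by apply: Rintegral_ge0 => x _; exact: truncate_cube_ge0.
  split.
  + exact: measurable_funM.
  + by apply: nearW => x; rewrite mulr_ge0// ?invr_ge0// truncate_cube_ge0.
  under eq_integral do rewrite EFinM.
  rewrite integralZl// -[X in (_ * X)%E]fineK; last exact: integrable_fin_num.
  by rewrite -EFinM mulVf.
- by apply: nearW => x xC; rewrite /truncate_cube indicE memNset// !mulr0.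
Qed.

(** On the cube p >= 0 a.e., so replacing h by its positive part moves it no further from p;
    outside, both functions vanish a.e. *)
Lemma dist1_truncate_cube h p : cube_pdf p -> mu.-integrable cube (EFin \o h) ->
  dist1 mu setT (truncate_cube h) p <= dist1 mu cube h p.
Proof.
move=> [ppdf pC] inth; have mC := measurable_unit_cube.
have intp := is_pdf_integrable ppdf.
have intpC : mu.-integrable cube (EFin \o p) by exact: integrableS intp.
have intt := integrable_truncate_cube inth.
have intd := integrable_dist measurableT intt intp.
have intdC := integrable_dist mC inth intpC.
rewrite /dist1 [leRHS]Rintegral_mkcond; apply: fine_le.
- exact: integrable_fin_num.
- apply: integrable_fin_num => //.
  have /(integrable_mkcond _ mC) := intdC.
  by congr (integrable _ _ _); apply/funext => x /=; rewrite !patchE; case: ifPn.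
have mintdC : measurable_fun [set: Rd R d]
    (fun x => (((fun x => `|h x - p x|) \_ cube) x)%:E).
  have /(integrable_mkcond _ mC)/integrableP[+ _] := intdC.
  by congr (measurable_fun _ _); apply/funext => x /=; rewrite !patchE; case: ifPn.
apply: ae_ge0_le_integral => //.
- by case/integrableP: intd.
- by move=> x _; rewrite lee_fin patchE; case: ifPn.
case: ppdf => _ p0 _; move: p0 pC; apply: filterS2 => x p0 pC _.
rewrite lee_fin patchE /truncate_cube indicE; case: ifPn => xC.
  rewrite mulr1; case: (leP (h x) 0) => h0 //.
  by rewrite sub0r normrN ger0_norm// ler0_norm; lra.
by rewrite mulr0 pC ?subrr ?normr0// => xC'; rewrite mem_set in xC.
Qed.

(** Dividing by the mass S moves the truncated function by |S - 1|, which is at most its distance to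
    p because p has mass 1. If S = 0 that distance is at least 1, and two densities are never more
    than 2 apart. *)
Lemma dist1_cube_density h p : cube_pdf p -> mu.-integrable cube (EFin \o h) ->
  dist1 mu setT (cube_density h) p <= 2 * dist1 mu cube h p.
Proof.
move=> cubep inth; have mC := measurable_unit_cube.
have [ppdf _] := cubep.
have intp := is_pdf_integrable ppdf.
have intt := integrable_truncate_cube inth.
have le_t := dist1_truncate_cube cubep inth.
have := dist1_set measurableT intt intp.
rewrite [X in _ - X](is_pdf_Rintegral ppdf) /cube_density.
set S := \int[mu]_x truncate_cube h x => S1.
have [S0|S0] := eqVneq S 0.
  have [pdf1 _] := indic_cube_pdf.
  have := dist1_pdf_le2 pdf1 ppdf.
  by move: S1; rewrite S0 sub0r normrN normr1; lra.
have Sge0 : 0 <= S.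
  by apply: Rintegral_ge0 => x _; exact: truncate_cube_ge0.
have intS : mu.-integrable [set: _] (EFin \o (fun x => S^-1 * truncate_cube h x)).
  by have := integrableZl measurableT S^-1 intt.
apply: le_trans (dist1_triangle measurableT intS intt intp) _.
suff : dist1 mu setT (fun x => S^-1 * truncate_cube h x) (truncate_cube h) = `|S - 1|.
  by move: S1 le_t; lra.
rewrite /dist1.
rewrite (@eq_Rintegral _ _ _ _ _ (fun x => `|S^-1 - 1| * truncate_cube h x));
  last first.
  move=> x _; rewrite -[X in _ - X]mul1r -mulrBl normrM; congr (_ * _).
  by rewrite ger0_norm// truncate_cube_ge0.
rewrite RintegralZl// -/S -[X in _ * X](ger0_norm Sge0) -normrM mulrBl mulVf// mul1r.
by rewrite distrC.
Qed.

End Normalization.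

(** * A countable dense family of densities *)

Section L1dense.
Import HBSimple.
Context (R : realType) (d : nat).
Local Notation mu := (lebesgue_Rd R d).
Local Notation C := (@unit_cube R d).
Local Notation integrable f := (mu.-integrable C (EFin \o f)).
Implicit Types f g h : Rd R d -> R.

Definition ray (j : 'I_d) (r : rat) : set (Rd R d) := [set x | tnth x j <= ratr r].

(* Finite rational combinations of products of indicators of rational
   half-spaces: a countable algebra of functions. *)
Definition ray_code := seq (rat * seq ('I_d * rat)).

Definition ray_fun (c : ray_code) (x : Rd R d) : R :=
  \sum_(al <- c) ratr al.1 * \prod_(jr <- al.2) \1_(ray jr.1 jr.2) x.

Lemma measurable_ray j r : measurable (ray j r).
Proof.
rewrite /ray -[X in measurable X]setTI; apply: measurable_fun_le => //.
exact: measurable_tnth.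
Qed.

Lemma measurable_ray_fun c : measurable_fun [set: _] (ray_fun c).
Proof.
apply: measurable_sum => al; apply: measurable_funM => //.
apply: measurable_prod => jr _; apply: measurable_indic; exact: measurable_ray.
Qed.

Lemma ray_fun_bounded c : exists2 M : R, 0 <= M & forall x, `|ray_fun c x| <= M.
Proof.
exists (\sum_(al <- c) `|ratr al.1|) => [|x]; first by apply: sumr_ge0.
apply: le_trans (ler_norm_sum _ _ _) _; apply: ler_sum => al _.
rewrite normrM ler_piMr// normr_prod; apply: prodr_ile1 => jr _.
by rewrite normr_ge0/= indicE; case: (_ \in _); rewrite ?normr1 ?normr0 ?lexx.
Qed.

Lemma integrable_ray_fun c : integrable (ray_fun c).
Proof.
apply: measurable_bounded_integrable.
- exact: measurable_unit_cube.
- exact: lebesgue_unit_cube_lty.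
- exact: measurable_funTS (measurable_ray_fun c).
have [M M0 cM] := ray_fun_bounded c.
exists M; split; first exact: num_real.
by move=> y My x _ /=; apply: (le_trans (cM x)); exact: ltW.
Qed.

Lemma ray_fun_cat c1 c2 x : ray_fun (c1 ++ c2) x = ray_fun c1 x + ray_fun c2 x.
Proof. by rewrite /ray_fun big_cat. Qed.

Lemma ray_fun_scale q c x :
  ray_fun [seq (q * al.1, al.2) | al <- c] x = ratr q * ray_fun c x.
Proof.
rewrite /ray_fun big_map mulr_sumr; apply: eq_bigr => al _ /=.
by rewrite rmorphM mulrA.
Qed.

Lemma ray_fun_mul c1 c2 x :
  ray_fun [seq (a.1 * b.1, a.2 ++ b.2) | a <- c1, b <- c2] x =
  ray_fun c1 x * ray_fun c2 x.
Proof.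
rewrite /ray_fun big_allpairs_dep mulr_suml; apply: eq_bigr => a _.
rewrite mulr_sumr; apply: eq_bigr => b _ /=.
by rewrite rmorphM big_cat/= mulrACA.
Qed.

Lemma dist1_le_comb (a b : R) f h f1 g1 f2 g2 : integrable f -> integrable h ->
  integrable f1 -> integrable g1 -> integrable f2 -> integrable g2 ->
  (forall x, `|f x - h x| <= a * `|f1 x - g1 x| + b * `|f2 x - g2 x|) ->
  dist1 mu C f h <= a * dist1 mu C f1 g1 + b * dist1 mu C f2 g2.
Proof.
move=> intf inth intf1 intg1 intf2 intg2 le_dist.
have mC := @measurable_unit_cube R d.
have int1 := integrable_dist mC intf1 intg1.
have int2 := integrable_dist mC intf2 intg2.
rewrite /dist1 -!RintegralZl// -RintegralD//; last 2 first.
- by have := integrableZl mC a int1.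
- by have := integrableZl mC b int2.
apply: le_Rintegral => //; first exact: integrable_dist.
apply: rintegrableD => //.
  by have := integrableZl mC a int1.
by have := integrableZl mC b int2.
Qed.

(** The 1 added in the denominator gives a usable tolerance even when the norm [b] vanishes. *)
Let mul_half (a b : R) : 0 <= a -> 0 <= b -> b * (a / (2 * (b + 1))) <= a / 2.
Proof.
move=> a0 b0; rewrite mulrA ler_pdivrMr; last by rewrite mulr_gt0// ltr_wpDl.
by rewrite mulrA divfK//; nra.
Qed.

(** The closure of the ray functions in L^1 of the cube. *)
Definition ray_approx h := integrable h /\
  forall eps, 0 < eps -> exists c, dist1 mu C (ray_fun c) h <= eps.

Lemma ray_approx_lim h : integrable h ->
  (forall eps, 0 < eps -> exists2 g, ray_approx g & dist1 mu C g h <= eps) ->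
  ray_approx h.
Proof.
move=> inth limh; split=> // eps eps0.
have eps20 : 0 < eps / 2 by rewrite divr_gt0.
have [g [intg /(_ _ eps20)[c cg]] gh] := limh _ eps20.
exists c; apply: le_trans (dist1_triangle _ (integrable_ray_fun c) intg inth) _.
  exact: measurable_unit_cube.
by rewrite [leRHS]splitr lerD.
Qed.

Lemma ray_approxD f g : ray_approx f -> ray_approx g -> ray_approx (f \+ g).
Proof.
move=> [intf fa] [intg ga]; have intfg : integrable (f \+ g).
  by apply: rintegrableD => //; exact: measurable_unit_cube.
split=> // eps eps0; have eps20 : 0 < eps / 2 by rewrite divr_gt0.
have [c cf] := fa _ eps20; have [c' cg] := ga _ eps20.
exists (c ++ c'); have := @dist1_le_comb 1 1 (ray_fun (c ++ c')) (f \+ g)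
  (ray_fun c) f (ray_fun c') g (integrable_ray_fun _) intfg
  (integrable_ray_fun _) intf (integrable_ray_fun _) intg.
have le_dist x : `|ray_fun (c ++ c') x - (f \+ g) x| <=
    1 * `|ray_fun c x - f x| + 1 * `|ray_fun c' x - g x|.
  by rewrite !mul1r ray_fun_cat opprD addrACA ler_normD.
by move/(_ le_dist)/le_trans; apply; rewrite !mul1r [leRHS]splitr lerD.
Qed.

(** Codes have rational coefficients, so [k] is replaced by a rational [q], close to it relative to
    the norm of [f]; the precision required of the code for [f] is then set according to |q|. *)
Lemma ray_approxZ k f : ray_approx f -> ray_approx (fun x => k * f x).
Proof.
move=> [intf fa]; have mC := @measurable_unit_cube R d.
have int0 : integrable (cst 0) by exact: integrable0.
have intkf : integrable (fun x => k * f x) by have := integrableZl mC k intf.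
split=> // eps eps0; pose N := dist1 mu C f (cst 0).
have N0 : 0 <= N by exact: dist1_ge0.
have [q qk] : exists q : rat, `|ratr q - k| <= eps / (2 * (N + 1)).
  have e0 : 0 < eps / (2 * (N + 1)) by rewrite divr_gt0// mulr_gt0// ltr_wpDl.
  have [q] : exists q : rat, ratr q \in `]k, k + eps / (2 * (N + 1))[.
    by apply: rat_in_itvoo; rewrite ltrDl.
  rewrite in_itv/= => /andP[kq qk]; exists q.
  by rewrite gtr0_norm ?subr_gt0// lerBlDl ltW.
have [c cf] : exists c, dist1 mu C (ray_fun c) f <= eps / (2 * (`|ratr q| + 1)).
  by apply: fa; rewrite divr_gt0// mulr_gt0// ltr_wpDl.
exists [seq (q * al.1, al.2) | al <- c].
have := @dist1_le_comb `|ratr q| `|ratr q - k|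
  (ray_fun [seq (q * al.1, al.2) | al <- c]) (fun x => k * f x)
  (ray_fun c) f f (cst 0) (integrable_ray_fun _) intkf (integrable_ray_fun _)
  intf intf int0.
have le_dist x : `|ray_fun [seq (q * al.1, al.2) | al <- c] x - k * f x| <=
    `|ratr q| * `|ray_fun c x - f x| + `|ratr q - k| * `|f x - cst 0 x|.
  rewrite ray_fun_scale subr0 -!normrM; apply: le_trans (ler_normD _ _).
  by rewrite mulrBr mulrBl addrA subrK.
move/(_ le_dist)/le_trans; apply; rewrite [leRHS]splitr lerD//.
  by rewrite (le_trans (ler_wpM2l (normr_ge0 _) cf))// mul_half// ltW.
by rewrite (le_trans (ler_wpM2r N0 qk))// mulrC mul_half// ltW.
Qed.

Lemma integrable_indic_on_cube A : measurable A -> integrable \1_A.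
Proof.
move=> mA; apply: measurable_bounded_integrable.
- exact: measurable_unit_cube.
- exact: lebesgue_unit_cube_lty.
- exact: measurable_indic.
exists 1; split; first exact: num_real.
move=> y y1 x _ /=; apply: le_trans (ltW y1).
by rewrite indicE; case: (_ \in _); rewrite ?normr1 ?normr0.
Qed.

Lemma ray_approx1 : ray_approx (cst 1).
Proof.
have r1 : ray_fun [:: (1, [::])] = cst 1.
  by apply/funext => x; rewrite /ray_fun big_seq1 big_nil rmorph1 mulr1.
split; first by rewrite -r1; exact: integrable_ray_fun.
move=> eps eps0; exists [:: (1, [::])]; rewrite r1 /dist1.
rewrite (@eq_Rintegral _ _ _ _ _ (cst 0)) ?Rintegral_cst ?mul0r ?ltW//.
  exact: measurable_unit_cube.
by move=> x _; rewrite subrr normr0.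
Qed.

Lemma ray_approx_ray j r : ray_approx \1_(ray j r).
Proof.
have r1 : ray_fun [:: (1, [:: (j, r)])] = \1_(ray j r).
  by apply/funext => x; rewrite /ray_fun !big_seq1 rmorph1 mul1r.
split; first by rewrite -r1; exact: integrable_ray_fun.
move=> eps eps0; exists [:: (1, [:: (j, r)])]; rewrite r1 /dist1.
rewrite (@eq_Rintegral _ _ _ _ _ (cst 0)) ?Rintegral_cst ?mul0r ?ltW//.
  exact: measurable_unit_cube.
by move=> x _; rewrite subrr normr0.
Qed.

Lemma ray_approx_setC A : ray_approx \1_A -> ray_approx \1_(~` A).
Proof.
move=> Aa; rewrite (_ : \1_(~` A) = cst 1 \+ (fun x => -1 * \1_A x)).
  exact: ray_approxD ray_approx1 (ray_approxZ _ Aa).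
apply/funext => x /=; rewrite !indicE in_setC.
by case: (_ \in _); rewrite /= mulN1r ?subrr ?subr0.
Qed.

(** Codes are closed under products, and ab - 1_A 1_B = b (a - 1_A) + 1_A (b - 1_B). The approximant
    b is fixed before a, because its sup bound dictates the precision of a. *)
Lemma ray_approx_setI A B : measurable A -> measurable B ->
  ray_approx \1_A -> ray_approx \1_B -> ray_approx \1_(A `&` B).
Proof.
move=> mA mB [intA Aa] [intB Ba].
have intAB : integrable \1_(A `&` B).
  by apply: integrable_indic_on_cube; exact: measurableI.
split=> // eps eps0; have eps20 : 0 < eps / 2 by rewrite divr_gt0.
have [b bB] := Ba _ eps20; have [M M0 bM] := ray_fun_bounded b.
have [a aA] : exists a, dist1 mu C (ray_fun a) \1_A <= eps / (2 * (M + 1)).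
  by apply: Aa; rewrite divr_gt0// mulr_gt0// ltr_wpDl.
pose c : ray_code := [seq (u.1 * v.1, u.2 ++ v.2) | u <- a, v <- b].
exists c; have := @dist1_le_comb M 1 (ray_fun c) \1_(A `&` B)
  (ray_fun a) \1_A (ray_fun b) \1_B (integrable_ray_fun _) intAB
  (integrable_ray_fun _) intA (integrable_ray_fun _) intB.
have le_dist x : `|ray_fun c x - \1_(A `&` B) x| <=
    M * `|ray_fun a x - \1_A x| + 1 * `|ray_fun b x - \1_B x|.
  rewrite ray_fun_mul indicI/= mul1r.
  rewrite (_ : _ - _ = ray_fun b x * (ray_fun a x - \1_A x) +
    \1_A x * (ray_fun b x - \1_B x)); last by ring.
  apply: le_trans (ler_normD _ _) _; rewrite !normrM lerD//.
    by rewrite ler_wpM2r.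
  by rewrite ler_piMl// indicE; case: (_ \in _); rewrite ?normr1 ?normr0.
move/(_ le_dist)/le_trans; apply; rewrite mul1r [leRHS]splitr lerD//.
by rewrite (le_trans (ler_wpM2l M0 aA))// mul_half// ltW.
Qed.

(** Finite unions follow from complements and intersections. What they miss of the full union
    decreases to the empty set inside the cube, which has finite measure, so its measure tends to
    0. *)
Lemma ray_approx_bigcup (F : (set (Rd R d))^nat) :
  (forall n, measurable (F n)) -> (forall n, ray_approx \1_(F n)) ->
  ray_approx \1_(\bigcup_n F n).
Proof.
move=> mF Fa; have mC := @measurable_unit_cube R d.
pose U n := \big[setU/set0]_(i < n) F i.
have mU n : measurable (U n) by exact: bigsetU_measurable.
have Ua n : ray_approx \1_(U n).
  elim: n => [|n IHn].
    rewrite /U big_ord0 -(setCK set0) setC0; apply: ray_approx_setC.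
    by rewrite indicT; exact: ray_approx1.
  have -> : U n.+1 = ~` (~` U n `&` ~` F n).
    by rewrite setCI !setCK /U big_ord_recr.
  apply/ray_approx_setC/ray_approx_setI; [exact: measurableC|exact: measurableC| |];
  exact: ray_approx_setC.
have mbF : measurable (\bigcup_n F n) by exact: bigcup_measurable.
apply: ray_approx_lim; first exact: integrable_indic_on_cube.
pose G n := C `&` (\bigcup_n F n `\` U n).
have mG n : measurable (G n) by apply: measurableI => //; exact: measurableD.
have GE : \bigcap_n G n = set0.
  rewrite -subset0 => x Gx; have [_ [[n _ Fnx] _]] := Gx 0 I.
  have [_ [_]] := Gx n.+1 I; apply.
  by rewrite /U big_ord_recr; right.
have : mu (G n) @[n --> \oo] --> 0%E.
  rewrite -(measure0 mu) -GE; apply: nonincreasing_cvg_mu => //.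
  - apply: le_lt_trans (lebesgue_unit_cube_lty R d).
    by apply: le_measure; rewrite ?inE//; exact: subIsetl.
  - by rewrite GE.
  move=> m n mn; apply/subsetPset; apply: setIS; apply: setDS.
  by apply: subset_bigsetU.
move=> G0 eps eps0; move/fine_cvgP : G0 => [_ /cvgrPdist_le /(_ eps eps0)].
move=> [N _ /(_ N (leqnn N))]; rewrite /= sub0r normrN => GN.
exists \1_(U N) => //; apply: le_trans GN; rewrite ger0_norm ?fine_ge0//.
rewrite /dist1 /Rintegral.
rewrite (eq_integral (fun x => (\1_(G N) x)%:E)); last first.
  move=> x; rewrite inE => Cx; congr (_%:E); rewrite !indicE.
  have [xU|xU] := boolP (x \in U N).
    rewrite (mem_set (_ : (\bigcup_n F n) x)).
      rewrite memNset ?subrr ?normr0// => -[_ [_]]; apply.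
      exact: set_mem.
    by move/set_mem: xU; rewrite /U -bigcup_mkord => -[i _ Fix]; exists i.
  by rewrite sub0r normrN normr_nat /G in_setI in_setD xU andbT (mem_set Cx).
by rewrite integral_indic// setIC /G setIA setIid.
Qed.

(** Rational thresholds tending to [b] from strictly above exhaust the open half-space by
    complements of rational rays. *)
Lemma ray_approx_ge (j : 'I_d) (b : R) : ray_approx \1_[set x : Rd R d | b < tnth
  x j].
Proof.
have /choice[q qP] : forall n, exists q : rat, ratr q \in `]b, b + n.+1%:R^-1[.
  by move=> n; apply: rat_in_itvoo; rewrite ltrDl.
rewrite (_ : [set x | _] = \bigcup_n ~` ray j (q n)).
  apply: ray_approx_bigcup => n; first by apply: measurableC; exact: measurable_ray.
  by apply: ray_approx_setC; exact: ray_approx_ray.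
apply/seteqP; split => x /=; last first.
  move=> [n _ /negP]; rewrite -ltNge; apply: lt_trans.
  by have := qP n; rewrite in_itv/= => /andP[].
move=> bx; have xb : 0 < tnth x j - b by rewrite subr_gt0.
have [n _ /(_ n (leqnn n))/= nxb] := near_infty_natSinv_lt (PosNum xb).
exists n => //=; apply/negP; rewrite -ltNge.
by have := qP n; rewrite in_itv/= => /andP[_] /lt_trans; apply; rewrite -ltrBrDl.
Qed.

(** The good sets form a sigma-algebra, so only generators matter. The argument is applied twice:
    the sigma-algebra of tuples is generated by preimages under coordinates, that of the line by the
    intervals ]a, b]. *)
Lemma ray_approx_measurable A : measurable A -> ray_approx \1_A.
Proof.
suff : measurable `<=` [set A : set (Rd R d) | measurable A /\ ray_approx \1_A].
  by move=> h /h[].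
clear A.
pose G := [set A : set (Rd R d) | measurable A /\ ray_approx \1_A].
have G0 : G set0.
  split => //; rewrite -(setCK set0) setC0; apply: ray_approx_setC.
  by rewrite indicT; exact: ray_approx1.
have GC A : G A -> G (~` A).
  by move=> [mA Aa]; split; [exact: measurableC|exact: ray_approx_setC].
have GU (F : (set (Rd R d))^nat) : (forall n, G (F n)) -> G (\bigcup_n F n).
  move=> GF; split; first by apply: bigcup_measurable => n _; case: (GF n).
  by apply: ray_approx_bigcup => n; case: (GF n).
apply: smallest_sub.
  by split => // A GA; rewrite setTD; exact: GC.
apply: (@big_ind _ (fun S => S `<=` G)) => //.
  by move=> S S' SG S'G A [/SG|/S'G].
move=> j _ _ [B mB <-]; rewrite setTI.
suff : measurable `<=` [set B : set (measurableTypeR R) | measurable B /\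
    ray_approx \1_((fun x : Rd R d => tnth x j) @^-1` B)].
  move=> /(_ _ mB)[_ Ba]; split => //.
  rewrite -[X in measurable X]setTI; exact: (measurable_tnth j measurableT mB).
have mj (B' : set (measurableTypeR R)) : measurable B' ->
    measurable ((fun x : Rd R d => tnth x j) @^-1` B').
  move=> mB'; rewrite -[X in measurable X]setTI.
  exact: (measurable_tnth j measurableT mB').
apply: smallest_sub.
  split => /=.
  - by split => //; rewrite preimage_set0; case: G0.
  - move=> B' [mB' Ba']; rewrite setTD; split; first exact: measurableC.
    by rewrite -preimage_setC; exact: ray_approx_setC.
  - move=> F mF; split; first by apply: bigcup_measurable => n _; case: (mF n).
    rewrite preimage_bigcup; apply: ray_approx_bigcup => n.
      by apply: mj; case: (mF n).
    by case: (mF n).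
move=> _ [[a b] _ <-] /=; split; first exact: measurable_itv.
rewrite (_ : _ @^-1` _ = [set x : Rd R d | a < tnth x j] `&`
    ~` [set x : Rd R d | b < tnth x j]); last first.
  apply/seteqP; split => x /=; rewrite in_itv/=.
    by move=> /andP[-> xb]; split => //; apply/negP; rewrite -leNgt.
  by move=> [-> /negP]; rewrite -leNgt.
have mray c : measurable [set x : Rd R d | c < tnth x j].
  have -> : [set x : Rd R d | c < tnth x j] =
      (fun x : Rd R d => tnth x j) @^-1` `]c, +oo[%classic.
    by apply/seteqP; split => x /=; rewrite in_itv/= andbT.
  exact: mj (measurable_itv _).
apply: ray_approx_setI => //; first exact: measurableC.
  exact: ray_approx_ge.
by apply: ray_approx_setC; exact: ray_approx_ge.
Qed.

Lemma ray_approx_sum (I : Type) (r : seq I) (F : I -> Rd R d -> R) :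
  (forall i, ray_approx (F i)) -> ray_approx (fun x => \sum_(i <- r) F i x).
Proof.
move=> Fa; elim: r => [|i r IHr].
  rewrite (_ : (fun _ => _) = \1_(~` setT)); last first.
    by apply/funext => x; rewrite big_nil setCT indic0.
  by apply: ray_approx_measurable; exact: measurableC.
rewrite (_ : (fun _ => _) = F i \+ (fun x => \sum_(i <- r) F i x)).
  exact: ray_approxD.
by apply/funext => x; rewrite big_cons.
Qed.

Lemma ray_approx_sfun (g : {sfun Rd R d >-> R}) : ray_approx g.
Proof.
rewrite (_ : (g : _ -> _) =
    (fun x => \sum_(y <- fset_set (range g)) y * \1_(g @^-1` [set y]) x)).
  apply: ray_approx_sum => y; apply/ray_approxZ/ray_approx_measurable.
  exact: measurable_sfunP.
by apply/funext => x; rewrite fimfunE fsbig_finite//; exact: fimfunP.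
Qed.

Lemma ray_approx_integrable h : integrable h -> ray_approx h.
Proof.
move=> inth; have mC := @measurable_unit_cube R d.
apply: ray_approx_lim => // eps eps0.
have [g [intg _ /fine_cvgP[_ /cvgrPdist_le /(_ eps eps0)]]] :=
  approximation_sfun_integrable mC inth.
move=> [N _ /(_ N (leqnn N))]; rewrite /= sub0r normrN => gN.
exists (g N); first exact: ray_approx_sfun.
apply: le_trans gN; rewrite dist1C ger0_norm ?fine_ge0 ?integral_ge0//.
Qed.

Lemma countable_dense_densities : exists g : nat -> Rd R d -> R,
  (forall i, cube_pdf (g i)) /\
  forall p, cube_pdf p -> forall eps, 0 < eps ->
    exists i, dist1 mu setT (g i) p <= eps.
Proof.
(* An index that decodes to no code yields the zero function, which [cube_density] turns into the
   uniform density. *)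
pose h (i : nat) := ray_fun (odflt [::] (choice.unpickle i : option ray_code)).
exists (fun i => cube_density (h i)); split=> [i|p cubep eps eps0].
  by apply: cube_density_pdf; [exact: measurable_ray_fun|exact: integrable_ray_fun].
have intp : integrable p.
  have [/is_pdf_integrable intp _] := cubep.
  by apply: integrableS intp => //; exact: measurable_unit_cube.
have [_ /(_ (eps / 2))[]] := ray_approx_integrable intp; first by rewrite divr_gt0.
move=> c cp; exists (choice.pickle (c : ray_code)); rewrite /h choice.pickleK/=.
apply: le_trans (dist1_cube_density cubep (integrable_ray_fun _)) _.
by rewrite mulrC -ler_pdivlMr.
Qed.

End L1dense.

(** * Product integrals and Lipschitz densities *)

Section ProductIntegral.
Context disp (T : measurableType disp) (R : realType).
Context (m : {sigma_finite_measure set T -> \bar R}).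

Lemma measurable_prod_tnth d (F : 'I_d -> T -> R) :
  (forall j, measurable_fun [set: T] (F j)) ->
  measurable_fun [set: d.-tuple T] (fun x => \prod_(j < d) F j (tnth x j)).
Proof.
move=> mF; apply: measurable_prod => j _.
by apply: measurableT_comp => //; exact: measurable_tnth.
Qed.

(** Tonelli's theorem, one coordinate at a time along [consM]. *)
Lemma integral_prod_tuple d (F : 'I_d -> T -> R) :
  (forall j, measurable_fun [set: T] (F j)) -> (forall j x, 0 <= F j x) ->
  (\int[tuple_measure m d]_x (\prod_(j < d) F j (tnth x j))%:E =
   \prod_(j < d) \int[m]_x (F j x)%:E)%E.
Proof.
elim: d F => [|d IHd] F mF F0.
  rewrite big_ord0 /=; under eq_integral do rewrite big_ord0.
  by rewrite integral_cst//= diracT mul1e.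
rewrite big_ord_recl /= /cons_measure.
rewrite ge0_integral_pushforward//=; last 3 first.
- exact: measurable_consM.
- by apply/measurable_EFinP; exact: measurable_prod_tnth.
- by move=> x _; rewrite lee_fin prodr_ge0.
rewrite preimage_setT; under eq_integral do rewrite /comp big_ord_recl.
pose G (t : d.-tuple T) := \prod_(j < d) F (lift ord0 j) (tnth t j).
transitivity (\int[(m \x tuple_measure m d)%E]_z (F ord0 z.1 * G z.2)%:E)%E.
  apply: eq_integral => -[x t] _ /=; congr (_ * _)%:E.
  by apply: eq_bigr => j _; rewrite tnthS.
have mG : measurable_fun [set: d.-tuple T] G.
  exact: (@measurable_prod_tnth d (fun j => F (lift ord0 j))).
have G0 t : 0 <= G t by exact: prodr_ge0.
rewrite fubini_tonelli1/=; last 2 first.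
- apply/measurable_EFinP; apply: measurable_funM.
    exact: measurableT_comp (mF _) measurable_fst.
  exact: measurableT_comp mG measurable_snd.
- by move=> z; rewrite lee_fin mulr_ge0.
transitivity (\int[m]_x ((F ord0 x)%:E *
    \prod_(j < d) \int[m]_y (F (lift ord0 j) y)%:E))%E.
  apply: eq_integral => x _; rewrite /fubini_F/=.
  rewrite -(IHd (fun j => F (lift ord0 j)))// -ge0_integralZl//.
  - by apply/measurable_EFinP.
  - by move=> t _; rewrite lee_fin prodr_ge0.
  - by rewrite lee_fin.
rewrite ge0_integralZr//.
- by apply/measurable_EFinP.
- by move=> x _; rewrite lee_fin.
- by apply: prode_ge0 => j _; apply: integral_ge0 => x _; rewrite lee_fin.
Qed.

End ProductIntegral.

(** * Pointwise bounds for Lipschitz densities on the line *)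

Section LipschitzDensity.
Context (R : realType).

Lemma lipschitzP (L : R) (q : R -> R) : L.-lipschitz q ->
  forall x y, `|q x - q y| <= L * `|x - y|.
Proof. by move=> h x y; apply: (h (x, y)). Qed.

(** A negative value would persist on an interval of positive length, against non-negativity almost
    everywhere. *)
Lemma lipschitz_pdf_ge0 (q : R -> R) (L : R) t :
  is_pdf (@lebesgue_measure R) q -> 0 <= L -> L.-lipschitz q -> 0 <= q t.
Proof.
move=> qpdf L0 qL; rewrite leNgt; apply/negP => qt.
have [_ [N [mN N0 subN]] _] := qpdf.
have L1 : 0 < 2 * (L + 1) by lra.
(* On [t, t + r] the function grows by at most L r < - q t / 2; L + 1 replaces L to allow L = 0. *)
pose r := - q t / (2 * (L + 1)).
have r0 : 0 < r by rewrite divr_gt0 ?oppr_gt0.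
have tr : `[t, t + r]%classic `<=` N.
  move=> s; rewrite /= in_itv/= => /andP[ts sr]; apply: subN => /=; apply/negP.
  rewrite -ltNge.
  have := lipschitzP qL s t; rewrite ler_norml => /andP[_].
  rewrite ger0_norm ?subr_ge0// => h.
  have : s - t <= r by lra.
  by rewrite /r ler_pdivlMr//; nra.
have := @le_measure _ _ _ (@lebesgue_measure R) `[t, t + r]%classic N.
rewrite !inE => /(_ (measurable_itv _) mN tr).
rewrite [X in (_ <= X)%E]N0 [X in (X <= _)%E](lebesgue_measure_itv `[t, t + r]).
by rewrite /= lte_fin ltrDl r0 -EFinB addrAC subrr add0r lee_fin leNgt r0.
Qed.

Lemma lipschitz_pdf_integral_le1 (q : R -> R) (L : R) :
  is_pdf (@lebesgue_measure R) q -> 0 <= L -> L.-lipschitz q ->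
  (\int[@lebesgue_measure R]_(x in `[0%R, 1%R]) (q x)%:E <= 1)%E.
Proof.
move=> qpdf L0 qL; have [mq _ <-] := qpdf.
apply: ge0_subset_integral => //=.
- exact/measurable_EFinP.
- by move=> x _; rewrite lee_fin (lipschitz_pdf_ge0 _ qpdf L0 qL).
Qed.

(** Otherwise q > 1 throughout [0, 1], where its integral is at most 1. *)
Lemma lipschitz_pdf_le (q : R -> R) (L : R) t :
  is_pdf (@lebesgue_measure R) q -> 0 <= L -> L.-lipschitz q ->
  0 <= t <= 1 -> q t <= 1 + L.
Proof.
move=> qpdf L0 qL /andP[t0 t1]; rewrite leNgt; apply/negP => qt.
have [mq _ _] := qpdf.
have : ((q t - L)%:E <= \int[@lebesgue_measure R]_(x in `[0%R, 1%R]) (q x)%:E)%E.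
  have <- : (\int[@lebesgue_measure R]_(x in `[0%R, 1%R]) (q t - L)%:E = (q t -
    L)%:E)%E.
    rewrite integral_cst//= lebesgue_measure_itv/= lte_fin ltr01 -EFinB subr0.
    by rewrite mule1.
  apply: ge0_le_integral => //=.
  - by move=> x _; rewrite lee_fin; lra.
  - by apply/measurable_EFinP; exact: measurable_funTS.
  move=> x; rewrite in_itv/= => /andP[x0 x1]; rewrite lee_fin.
  have := lipschitzP qL t x; rewrite ler_norml => /andP[_].
  have : `|t - x| <= 1 by rewrite ler_norml; lra.
  nra.
move=> /le_trans/(_ (lipschitz_pdf_integral_le1 qpdf L0 qL)); rewrite lee_fin; lra.
Qed.

End LipschitzDensity.

(** * Approximation of mixtures by products of step functions *)

Section NLFamily.
Context (R : realType) (d : nat).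
Local Notation mu := (lebesgue_Rd R d).
Local Notation C := (@unit_cube R d).

(* The factors [f j + 1] have integral at most 2 on [0, 1] when [f j] is a
   density, whereas bounds through sup norms would involve the Lipschitz
   constants and spoil the rate. *)
Lemma dist_prod_le e (f h : 'I_e -> R) (eta : R) : 0 <= eta -> eta <= 1 ->
  (forall j, 0 <= f j) -> (forall j, 0 <= h j) ->
  (forall j, `|f j - h j| <= eta) ->
  `|\prod_(j < e) f j - \prod_(j < e) h j| <= e%:R * eta * \prod_(j < e) (f j + 1).
Proof.
move=> eta0 eta1; elim: e f h => [|e IHe] f h f0 h0 fh.
  by rewrite !big_ord0 subrr normr0 !mul0r.
rewrite !big_ord_recl; set F := \prod_(i < e) f _; set H := \prod_(i < e) h _.
set G := \prod_(i < e) _.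
have FH : `|F - H| <= e%:R * eta * G by exact: IHe.
have H0 : 0 <= H by exact: prodr_ge0.
have G0 : 0 <= G by apply: prodr_ge0 => i _; rewrite addr_ge0.
have HG : H <= G.
  apply: ler_prod => i _; rewrite h0/=.
  by have := fh (lift ord0 i); rewrite ler_norml; lra.
rewrite (_ : _ - _ = f ord0 * (F - H) + (f ord0 - h ord0) * H); last by ring.
apply: le_trans (ler_normD _ _) _; rewrite !normrM (ger0_norm (f0 _)) (ger0_norm H0).
have h1 : f ord0 * `|F - H| <= f ord0 * (e%:R * eta * G) by rewrite ler_wpM2l.
have h2 : `|f ord0 - h ord0| * H <= eta * G by exact: ler_pM.
apply: le_trans (lerD h1 h2) _.
have e0 : 0 <= e%:R :> R by [].
have := f0 ord0; have := mulr_ge0 eta0 G0; rewrite -natr1.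
have := mulr_ge0 (mulr_ge0 e0 eta0) G0; have := mulr_ge0 (f0 ord0) (mulr_ge0 eta0 G0).
rewrite (_ : (e%:R + 1) * eta * ((f ord0 + 1) * G) = f ord0 * (e%:R * eta * G) +
   eta * G + e%:R * eta * G + f ord0 * (eta * G)); last by ring.
lra.
Qed.

(* The additional bin [1, 1 + 1/b[ makes the grid cover the endpoint 1. *)
Definition grid_step b (a : 'I_b.+1 -> R) (t : R) : R :=
  \sum_(m < b.+1) a m * \1_(`[m%:R / b%:R, m.+1%:R / b%:R[%classic) t.

Lemma measurable_grid_step b (a : 'I_b.+1 -> R) :
  measurable_fun [set: measurableTypeR R] (grid_step a).
Proof.
apply: measurable_sum => m; apply: measurable_funM => //.
Qed.

Lemma grid_stepE b (a : 'I_b.+1 -> R) (t : R) : (0 < b)%N -> 0 <= t <= 1 ->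
  exists2 m : 'I_b.+1, grid_step a t = a m &
    let s : R := m%:R / b%:R in 0 <= s <= 1 /\ `|t - s| <= (b%:R^-1 : R).
Proof.
move=> b0 /andP[t0 t1]; have b0' : 0 < b%:R :> R by rewrite ltr0n.
have tb0 : 0 <= t * b%:R by rewrite mulr_ge0// ltW.
(* For t = 1 this is [b], the index of the additional bin. *)
pose m := Num.truncn (t * b%:R).
have /andP[mt tm] := truncn_itv tb0; rewrite -/m in mt tm.
have mb : (m < b.+1)%N.
  by rewrite ltnS -(ler_nat R) (le_trans mt)// ler_piMl// ltW.
exists (Ordinal mb); last first.
  rewrite /= divr_ge0 ?ler_pdivrMr ?mul1r ?ler_nat ?(ltW b0')//=; split=> //.
  have tmb : t * b%:R - m%:R <= 1 by move: tm; rewrite -natr1; lra.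
  rewrite ger0_norm ?subr_ge0 ?ler_pdivrMr// -(ler_pM2r b0') mulrBl.
  by rewrite divfK ?gt_eqF// mulVf// gt_eqF.
rewrite /grid_step (bigD1 (Ordinal mb))//= indicE mem_set ?mulr1; last first.
  by rewrite /= in_itv/= ler_pdivrMr// ltr_pdivlMr// mt tm.
rewrite big1 ?addr0// => i im; rewrite indicE memNset ?mulr0//= in_itv/=.
rewrite ler_pdivrMr// ltr_pdivlMr// => ti; move: im; rewrite -val_eqE/=.
by rewrite eq_sym => /eqP; apply; exact/truncn_def.
Qed.

(** Numerator of [y] rounded down to a multiple of 1/n; [inord] preserves it as long as n y <= M. *)
Definition round_ord n M (y : R) : 'I_M.+1 := inord (Num.truncn (n%:R * y)).

Lemma round_ordP n M (y : R) : (0 < n)%N -> 0 <= y -> n%:R * y <= M%:R ->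
  `|y - (round_ord n M y)%:R / n%:R| <= n%:R^-1.
Proof.
move=> n0 y0 yM; have n0' : 0 < n%:R :> R by rewrite ltr0n.
have ny0 : 0 <= n%:R * y by rewrite mulr_ge0// ltW.
have /andP[h1 h2] := truncn_itv ny0.
rewrite /round_ord inordK; last by rewrite ltnS -(ler_nat R) (le_trans h1).
move: (Num.truncn _) h1 h2 => m h1 h2.
rewrite ger0_norm; last by rewrite subr_ge0 ler_pdivrMr// mulrC.
rewrite -(ler_pM2l n0') mulrBr mulrCA !divff ?gt_eqF// mulr1.
by move: h2; rewrite -natr1; lra.
Qed.

(** L / b is the variation of [q] within a bin, 1/n the rounding of its value at the left
    endpoint. *)
Lemma grid_step_approx n M b (q : R -> R) (L : R) t : (0 < n)%N -> (0 < b)%N ->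
  (forall s, 0 <= q s) -> 0 <= L -> L.-lipschitz q ->
  (forall s, 0 <= s <= 1 -> n%:R * q s <= M%:R) -> 0 <= t <= 1 ->
  `|q t - grid_step (fun m : 'I_b.+1 => (round_ord n M (q (m%:R / b%:R)))%:R /
    n%:R) t|
    <= L / b%:R + n%:R^-1.
Proof.
move=> n0 b0 q0 L0 qL qM t01; set a := (X in grid_step X).
have [m -> [m01 tm]] := grid_stepE a b0 t01.
apply: le_trans (ler_distD (q (m%:R / b%:R)) _ _) _; apply: lerD.
  by rewrite (le_trans (lipschitzP qL _ _))// ler_wpM2l.
by apply: round_ordP => //; exact: qM.
Qed.

Lemma grid_step_ge0 b (a : 'I_b.+1 -> R) t :
  (forall m, 0 <= a m) -> 0 <= grid_step a t.
Proof. by move=> a0; apply: sumr_ge0 => m _; rewrite mulr_ge0. Qed.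

(* A code stores the numerators of mixture weights and of step values, all with
   common denominator [n]. *)
Definition nl_code k b M :=
  ({ffun 'I_k -> 'I_M.+1} * {ffun 'I_k * 'I_d * 'I_b.+1 -> 'I_M.+1})%type.

Definition nl_fun n k b M (c : nl_code k b M) (x : Rd R d) : R :=
  \sum_(i < k) (c.1 i)%:R / n%:R *
    \prod_(j < d) grid_step (fun m => (c.2 (i, j, m))%:R / n%:R) (tnth x j).

Lemma measurable_nl_fun n k b M (c : nl_code k b M) :
  measurable_fun [set: Rd R d] (nl_fun n c).
Proof.
apply: measurable_sum => i; apply: measurable_funM => //.
apply: (@measurable_prod_tnth _ (measurableTypeR R) R d
  (fun j => grid_step (fun m => (c.2 (i, j, m))%:R / n%:R))) => j.
exact: measurable_grid_step.
Qed.

Lemma integrable_nl_fun n k b M (c : nl_code k b M) :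
  mu.-integrable C (EFin \o nl_fun n c).
Proof.
apply: measurable_bounded_integrable.
- exact: measurable_unit_cube.
- exact: lebesgue_unit_cube_lty.
- exact: measurable_funTS (measurable_nl_fun _ _).
pose B (i : 'I_k) (j : 'I_d) : R := \sum_(m < b.+1) (c.2 (i, j, m))%:R / n%:R.
exists (\sum_(i < k) (c.1 i)%:R / n%:R * \prod_(j < d) B i j).
split; first exact: num_real.
move=> y By x _ /=; apply: le_trans (ltW By); rewrite ger0_norm; last first.
  apply: sumr_ge0 => i _; rewrite mulr_ge0// prodr_ge0// => j _.
  exact: grid_step_ge0.
apply: ler_sum => i _; rewrite ler_wpM2l//; apply: ler_prod => j _.
rewrite grid_step_ge0//=; apply: ler_sum => m _.
by rewrite ler_piMr// indicE; case: (_ \in _).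
Qed.

Lemma integral_cube_prod (F : 'I_d -> R -> R) :
  (forall j, measurable_fun [set: R] (F j)) -> (forall j t, 0 <= F j t) ->
  (\int[mu]_(x in C) (\prod_(j < d) F j (tnth x j))%:E =
   \prod_(j < d) \int[@lebesgue_measure R]_(t in `[0%R, 1%R]) (F j t)%:E)%E.
Proof.
move=> mF F0; pose G j t := F j t * \1_(`[0, 1]%classic) t.
have mG j : measurable_fun [set: R] (G j).
  apply: measurable_funM => //.
transitivity (\int[mu]_x (\prod_(j < d) G j (tnth x j))%:E)%E.
  rewrite integral_mkcond; apply: eq_integral => x _; rewrite patchE big_split/=.
  case: ifPn => xC.
    rewrite [X in _ * X]big1 ?mulr1// => j _; rewrite indicE mem_set//= in_itv/=.
    by move/set_mem: xC; exact.
  move: xC; rewrite notin_setE => /existsNP[j xj].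
  by rewrite [X in _ * X](bigD1 j)//= indicE memNset ?mul0r ?mulr0//=.
rewrite (@integral_prod_tuple _ (measurableTypeR R) R _ d G)//; last first.
  by move=> j t; rewrite mulr_ge0.
apply: eq_bigr => j _; rewrite [RHS]integral_mkcond; apply: eq_integral => t _.
by rewrite patchE /G indicE; case: ifPn => _; rewrite ?mulr1 ?mulr0.
Qed.

End NLFamily.

Section NLApprox.
Context (R : realType) (d : nat).
Local Notation mu := (lebesgue_Rd R d).
Local Notation C := (@unit_cube R d).

Lemma lipschitz_const_ge0 (L : R) (q : R -> R) : L.-lipschitz q -> 0 <= L.
Proof.
move=> /lipschitzP/(_ 1 0); rewrite subr0 normr1 mulr1.
exact: le_trans.
Qed.

Lemma nneseries_term_le (w : R^nat) i : (forall i, 0 <= w i) ->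
  ((w i)%:E <= \sum_(0 <= i <oo) (w i)%:E)%E.
Proof.
move=> w0; apply: le_trans (nneseries_lim_ge i.+1 _) => [|j _ _]; last first.
  by rewrite lee_fin.
by rewrite big_nat_recr//= leeDr// sume_ge0// => j _; rewrite lee_fin.
Qed.

Lemma lee_nneseries_tail (u v : (\bar R)^nat) k : (forall i, 0 <= u i)%E ->
  (forall i, 0 <= v i)%E -> (forall i, (k <= i)%N -> (u i <= v i)%E) ->
  (\sum_(k <= i <oo) u i <= \sum_(k <= i <oo) v i)%E.
Proof.
move=> u0 v0 uv; rewrite -(nneseries_addn k u0) -(nneseries_addn k v0).
by apply: lee_nneseries => // i _; rewrite uv// leq_addl.
Qed.

(** The weight [w] is kept in front of d eta: summed over the components this costs d eta in total,
    not k d eta, and only the rounding error r of the weights is paid k times. *)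
Lemma dist_weighted_prod_le (w w' r eta : R) (f h : 'I_d -> R) :
  0 <= w -> `|w - w'| <= r -> 0 <= eta -> eta <= 1 ->
  (forall j, 0 <= f j) -> (forall j, 0 <= h j) ->
  (forall j, `|f j - h j| <= eta) ->
  `|w' * \prod_(j < d) h j - w * \prod_(j < d) f j| <=
  (w * (d%:R * eta) + r) * \prod_(j < d) (f j + 1).
Proof.
move=> w0 ww' eta0 eta1 f0 h0 fh.
have := dist_prod_le eta0 eta1 f0 h0 fh.
set F := \prod_(j < d) f j; set H := \prod_(j < d) h j; set G := \prod_(j < d) _.
move=> FH.
have H0 : 0 <= H by exact: prodr_ge0.
have HG : H <= G.
  apply: ler_prod => i _; rewrite h0/=.
  by have := fh i; rewrite ler_norml; lra.
rewrite (_ : _ - _ = (w' - w) * H + w * (H - F)); last by ring.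
apply: le_trans (ler_normD _ _) _; rewrite !normrM (ger0_norm w0) (ger0_norm H0).
have h1 : `|w' - w| * H <= r * G by rewrite distrC; exact: ler_pM.
have h2 : w * `|H - F| <= w * (d%:R * eta * G) by rewrite distrC ler_wpM2l.
apply: le_trans (lerD h1 h2) _.
by rewrite mulrDl addrC -!mulrA.
Qed.

(** Pointwise the error is at most the sum of v_i G_i, where G_i is the product of the q_ij + 1.
    Each G_i integrates to at most 2^d over the cube, since each q_ij + 1 has integral at most 2 on
    [0, 1], and the v_i sum to at most W + d eta + k/n. The condition n (1 + L) <= M keeps all
    roundings in range: weights are at most 1 and the first k densities at most 1 + L on [0, 1]. *)
Lemma nl_family_approx n k b M (p : Rd R d -> R) (w l : R^nat)
    (q : nat -> 'I_d -> R -> R) (L W : R) :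
  cube_pdf p -> (0 < n)%N -> (0 < b)%N -> (forall i, 0 <= w i) ->
  (\sum_(0 <= i <oo) (w i)%:E = 1)%E ->
  (forall i j, is_pdf (@lebesgue_measure R) (q i j)) ->
  (forall i j, (l i).-lipschitz (q i j)) ->
  {ae mu, forall x, (p x)%:E =
     (\sum_(0 <= i <oo) (w i * \prod_(j < d) q i j (tnth x j))%:E)%E} ->
  (forall i, (i < k)%N -> l i <= L) -> 0 <= L ->
  n%:R * (1 + L) <= M%:R -> L / b%:R + n%:R^-1 <= 1 ->
  (\sum_(k <= i <oo) (w i)%:E <= W%:E)%E ->
  exists c : nl_code d k b M, dist1 mu C (nl_fun n c) p <=
    2 ^+ d * (W + d%:R * (L / b%:R + n%:R^-1) + k%:R / n%:R).
Proof.
move=> cubep n0 b0 w0 sumw qpdf qlip paE lL L0 nM eta1 tailW.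
set eta := L / b%:R + n%:R^-1 in eta1 *.
have n0' : 0 < n%:R :> R by rewrite ltr0n.
have b0' : 0 < b%:R :> R by rewrite ltr0n.
have eta0 : 0 <= eta by rewrite addr_ge0 ?invr_ge0// divr_ge0.
have mC := @measurable_unit_cube R d.
have q0 i j t : 0 <= q i j t.
  by apply: lipschitz_pdf_ge0 (qpdf i j) _ (qlip i j); exact: lipschitz_const_ge0
    (qlip i j).
have mq i j : measurable_fun [set: R] (q i j) by case: (qpdf i j).
have mq1 i j : measurable_fun [set: R] (fun t => q i j t + 1).
  exact: measurable_funD.
have w1 i : w i <= 1 by rewrite -lee_fin -sumw; exact: nneseries_term_le.
pose G i (x : Rd R d) := \prod_(j < d) (q i j (tnth x j) + 1).
(* The first k terms are approximated; the others are discarded and count as error in full. *)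
pose v i := if (i < k)%N then w i * (d%:R * eta) + n%:R^-1 else w i.
have G0 i x : 0 <= G i x by apply: prodr_ge0 => j _; rewrite addr_ge0.
have v0 i : 0 <= v i.
  by rewrite /v; case: ifP => // _; rewrite addr_ge0 ?invr_ge0// mulr_ge0// mulr_ge0.
have mG i : measurable_fun [set: Rd R d] (G i).
  apply: (@measurable_prod_tnth _ (measurableTypeR R) R d (fun j t => q i j t +
    1)) => j.
  exact: mq1.
have intG i : (\int[mu]_(x in C) (G i x)%:E <= (2 ^+ d)%:E)%E.
  rewrite (@integral_cube_prod R d (fun j t => q i j t + 1)); last 2 first.
  - by move=> j; exact: mq1.
  - by move=> j t; rewrite addr_ge0.
  rewrite -[in leRHS](card_ord d) -prodr_const -prodEFin.
  suff : (0 <= \prod_(j < d) \int[@lebesgue_measure R]_(t in `[0%R, 1%R])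
      (q i j t + 1)%:E <= \prod_(j in 'I_d) 2%:E)%E by case/andP.
  apply: (big_ind2 (fun y z => 0 <= y <= z)%E) => [|y z y' z'|j _].
  - by rewrite lexx lee01.
  - by move=> /andP[y0 yz] /andP[y0' yz']; rewrite mule_ge0//= lee_pmul.
  apply/andP; split; first by apply: integral_ge0 => t _; rewrite lee_fin addr_ge0.
  under eq_integral do rewrite EFinD.
  rewrite ge0_integralD//=.
  - rewrite (_ : 2 = 1 + 1)// EFinD; apply: leeD.
      exact: lipschitz_pdf_integral_le1 (qpdf i j) (lipschitz_const_ge0 (qlip i
        j)) (qlip i j).
    rewrite integral_cst//= [X in (_ * X)%E](lebesgue_measure_itv `[0%R, 1%R]).
    by rewrite /= lte_fin ltr01 mul1e -EFinB subr0.
  - by move=> t _; rewrite lee_fin.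
  - by apply/measurable_EFinP; exact: measurable_funTS (mq i j).
pose c : nl_code d k b M := ([ffun i : 'I_k => round_ord n M (w i)],
  [ffun u : 'I_k * 'I_d * 'I_b.+1 => round_ord n M (q u.1.1 u.1.2 (u.2%:R / b%:R))]).
exists c.
have le_v : {ae mu, forall x, C x -> (`|nl_fun n c x - p x|%:E <=
    \sum_(0 <= i <oo) (v i * G i x)%:E)%E}.
  apply: filterS paE => x; pose P i := \prod_(j < d) q i j (tnth x j).
  have P0 i : 0 <= P i by exact: prodr_ge0.
  move=> pE0 xC.
  have pE : (p x)%:E = (\sum_(0 <= i <oo) (w i * P i)%:E)%E by exact: pE0.
  move: pE {pE0}.
  have wP0 i : (0 <= (w i * P i)%:E)%E by rewrite lee_fin mulr_ge0.
  have vG0 i : (0 <= (v i * G i x)%:E)%E by rewrite lee_fin mulr_ge0.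
  rewrite (nneseries_split 0 k)// add0n sumEFin.
  rewrite [X in _ -> (_ <= X)%E](nneseries_split 0 k)// add0n sumEFin.
  set S := \sum_(0 <= i < k) _; set T := (\sum_(k <= i <oo) (w i * P i)%:E)%E.
  set U := \sum_(0 <= i < k) _; set V := (\sum_(k <= i <oo) (v i * G i x)%:E)%E.
  move=> pE.
  have T0 : (0 <= T)%E by exact: nneseries_ge0.
  have TV : (T <= V)%E.
    apply: lee_nneseries_tail => // i ki.
    rewrite /v ltnNge ki/= lee_fin ler_wpM2l//.
    by apply: ler_prod => j _; rewrite q0/= lerDl.
  (* The tail is finite because the whole series equals the real number [p x]. *)
  have TE : T = (p x - S)%:E by rewrite EFinB pE addeAC subee// add0e.
  have nlU : `|nl_fun n c x - S| <= U.
    rewrite /S /U !big_mkord /nl_fun -sumrB.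
    apply: le_trans (ler_norm_sum _ _ _) _; apply: ler_sum => i _.
    rewrite /v ltn_ord; apply: dist_weighted_prod_le => // [|j|j].
    - rewrite ffunE; apply: round_ordP => //.
      by apply: le_trans nM; rewrite ler_pM2l// (le_trans (w1 i))// lerDl.
    - by apply: grid_step_ge0 => m; rewrite divr_ge0.
    - rewrite (_ : (fun m => _) = (fun m : 'I_b.+1 =>
          (round_ord n M (q i j (m%:R / b%:R)))%:R / n%:R)); last first.
        by apply/funext => m; rewrite ffunE.
      have li0 := lipschitz_const_ge0 (qlip i j).
      apply: le_trans (grid_step_approx n0 b0 (q0 i j) li0 (qlip i j) _ (xC j)) _.
        move=> s s01; apply: le_trans nM; rewrite ler_pM2l//.
        apply: le_trans (lipschitz_pdf_le (qpdf i j) li0 (qlip i j) s01) _.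
        by rewrite lerD2l lL.
      by rewrite lerD2r ler_wpM2r ?invr_ge0// lL.
  have nlU' : (`|nl_fun n c x - S|%:E <= U%:E)%E by rewrite lee_fin.
  apply: le_trans (leeD nlU' TV).
  move: T0; rewrite TE !lee_fin => pS.
  by rewrite (le_trans (ler_distD S _ _))// lerD2l distrC ger0_norm.
rewrite -lee_fin /dist1 /Rintegral fineK; last first.
  apply: integrable_fin_num => //; apply: integrable_dist => //.
    exact: integrable_nl_fun.
  have [/is_pdf_integrable intp _] := cubep.
  exact: integrableS intp.
apply: (@le_trans _ _ (\int[mu]_(x in C) \sum_(0 <= i <oo) (v i * G i x)%:E)%E).
  apply: ae_ge0_le_integral => //.
  - apply/measurable_EFinP; apply: measurableT_comp => //.
    apply: measurable_funTS; apply: measurable_funB; first exact: measurable_nl_fun.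
    by case: cubep => -[].
  - by move=> x _; apply: nneseries_ge0 => i _ _; rewrite lee_fin mulr_ge0.
  - apply: ge0_emeasurable_sum => [i x _ _|i _].
      by rewrite lee_fin mulr_ge0.
    apply/measurable_EFinP; apply: measurable_funM => //.
    exact: measurable_funTS.
rewrite integral_nneseries//=; last 2 first.
- move=> i; apply/measurable_EFinP; apply: measurable_funM => //.
  exact: measurable_funTS.
- by move=> i x _; rewrite lee_fin mulr_ge0.
apply: (@le_trans _ _ (\sum_(0 <= i <oo) ((2 ^+ d)%:E * (v i)%:E))%E).
  apply: lee_nneseries => [i _ _|i _].
    by apply: integral_ge0 => x _; rewrite lee_fin mulr_ge0.
  under eq_integral do rewrite EFinM.
  rewrite ge0_integralZl//; [|by apply/measurable_EFinP; exact: measurable_funTS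
    |by move=> x _; rewrite lee_fin|by rewrite lee_fin].
  by rewrite muleC lee_wpmul2r// lee_fin.
rewrite nneseriesZl; last by move=> i _; rewrite lee_fin.
rewrite [leRHS]EFinM; apply: lee_wpmul2l; first by rewrite lee_fin exprn_ge0.
rewrite (nneseries_split 0 k); last by move=> i _; rewrite lee_fin.
rewrite add0n sumEFin.
have tailV : (\sum_(k <= i <oo) (v i)%:E <= W%:E)%E.
  apply: le_trans tailW; apply: lee_nneseries_tail => i; rewrite ?lee_fin//.
  by move=> ki; rewrite /v ltnNge ki.
rewrite -addrA addrC EFinD leeD// lee_fin.
have sumw1 : \sum_(0 <= i < k) w i <= 1.
  rewrite -lee_fin -sumEFin -sumw; apply: nneseries_lim_ge => i _ _.
  by rewrite lee_fin.
rewrite (eq_big_nat _ _ (F2 := fun i => w i * (d%:R * eta) + n%:R^-1)); last first.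
  by move=> i /andP[_ ik]; rewrite /v ik.
rewrite big_split/= -mulr_suml sumr_const_nat subn0 -[X in _ + X]mulr_natl lerD//.
by rewrite ler_piMl// mulr_ge0.
Qed.

End NLApprox.

(** * Rates *)

Section Rates.
Context (R : realType).

Lemma near_ge_powR (c A : R) : 0 < c -> \forall n \near \oo, A <= n%:R `^ c.
Proof.
move=> c0; near=> n.
have [A0|A0] := leP A 0; first by rewrite (le_trans A0)// powR_ge0.
have -> : A = (A `^ c^-1) `^ c by rewrite -powRrM mulVf ?gt_eqF// powRr1// ltW.
apply: ge0_ler_powR; rewrite ?nnegrE ?powR_ge0//; first exact: ltW.
by apply/ltW; near: n; exact: nbhs_infty_gtr.
Unshelve. all: by end_near. Qed.

Lemma near_ge_ln (A : R) : \forall n \near \oo, A <= ln n%:R.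
Proof.
near=> n; rewrite -[A]expRK ler_ln ?posrE ?expR_gt0//; last first.
  by rewrite ltr0n; near: n; exact: nbhs_infty_gt.
by apply/ltW; near: n; exact: nbhs_infty_gtr.
Unshelve. all: by end_near. Qed.

Lemma near_powRN_le (c e : R) : 0 < c -> 0 < e ->
  \forall n \near \oo, n%:R `^ (- c) <= e.
Proof.
move=> c0 e0; apply: filterS (near_ge_powR e^-1 c0) => n h.
rewrite powRN invf_ple ?posrE//; apply: lt_le_trans h; by rewrite invr_gt0.
Qed.

(** This is ln y <= y - 1 at y = n^c; at n = 0 the convention ln 0 = 0 is used. *)
Lemma ln_le_powR (c : R) n : 0 < c -> ln n%:R <= c^-1 * n%:R `^ c :> R.
Proof.
move=> c0; case: n => [|n].
  by rewrite ln0// mulr_ge0 ?powR_ge0// invr_ge0 ltW.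
rewrite -(ler_pM2l c0) mulrA divff ?gt_eqF// mul1r -ln_powR.
apply: le_trans (_ : _ <= n.+1%:R `^ c - 1) _; last by lra.
by rewrite -[X in ln X](subrK 1) addrC le_ln1Dx// ltrBrDl subrr powR_gt0.
Qed.

(** Half of the exponent absorbs the logarithm, the other half still tends to 0. *)
Lemma near_powRN_ln_le (c e : R) : 0 < c -> 0 < e ->
  \forall n \near \oo, n%:R `^ (- c) * ln n%:R <= e.
Proof.
move=> c0 e0; have c20 : 0 < c / 2 by rewrite divr_gt0.
have ec : 0 < e * (c / 2) by rewrite mulr_gt0.
apply: filterS2 (near_powRN_le c20 ec) (nbhs_infty_gt 0) => n h n0.
have n0' : 0 < n%:R :> R by rewrite ltr0n.
have h1 := ler_wpM2l (powR_ge0 n%:R (- c)) (ln_le_powR n c20).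
apply: le_trans h1 _; rewrite mulrCA -powRD; last first.
  by rewrite (gt_eqF n0') implybT.
have -> : - c + c / 2 = - (c / 2) by lra.
by rewrite mulrC ler_pdivrMr.
Qed.

Lemma truncnS_bounds (x : R) : 1 <= x ->
  x <= (Num.truncn x).+1%:R <= 2 * x.
Proof.
move=> x1; have x0 : 0 <= x by exact: le_trans x1.
have /andP[h1 h2] := truncn_itv x0; apply/andP; split; first exact: ltW.
by rewrite -natr1; lra.
Qed.

Lemma ge1_powR n (c : R) : (0 < n)%N -> 0 <= c -> 1 <= n%:R `^ c.
Proof.
move=> n0 c0; rewrite -[leLHS](powRr0 n%:R).
by apply: ler_powR => //; rewrite ler1n.
Qed.

(** The hypothesis on l gives s l^2 / 8 >= (2 D + 2) s l: here 2 D s l pays for N^2, one s l for the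
    factor 2, and the last one leaves exp(- s l) <= exp(- l). *)
Lemma union_bound_le (D s l : R) (N : nat) : 0 <= D -> 1 <= s ->
  8 * (2 * D + 2) <= l -> N%:R <= expR (D * s * l) ->
  (N ^ 2)%:R * (2 * expR (- (s * l ^+ 2 / 8))) <= expR (- l).
Proof.
move=> D0 s1 lD Nle; have l1 : 1 <= l by lra.
have sl1 : 1 <= s * l by rewrite -[leLHS]mulr1; apply: ler_pM.
have two : 2 <= expR (s * l).
  by apply: le_trans (expR_ge1Dx _); rewrite -lerBlDl; lra.
have N2 : (N ^ 2)%:R <= expR (2 * (D * s * l)).
  rewrite natrX mulrC expRM_natr.
  by rewrite lerXn2r ?nnegrE ?expR_ge0.
apply: (@le_trans _ _ (expR (2 * (D * s * l)) *
    (expR (s * l) * expR (- (s * l ^+ 2 / 8))))).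
  have E0 : 0 <= expR (- (s * l ^+ 2 / 8)) by exact: expR_ge0.
  by apply: ler_pM => //; exact: ler_wpM2r.
rewrite -!expRD ler_expR.
have : s * l * (8 * (2 * D + 2)) <= s * l * l by rewrite ler_wpM2l//; lra.
have : l <= s * l by rewrite ler_peMl//; lra.
rewrite expr2; lra.
Qed.

Lemma card_nl_index n d k b M :
  #|{: 'I_n.+1 + nl_code d k b M}| = (n.+1 + M.+1 ^ (k + k * d * b.+1))%N.
Proof.
by rewrite card_sum card_ord card_prod !card_ffun !card_prod !card_ord expnD.
Qed.

End Rates.

(** * Choice of the parameters and size of the family *)

Section RateParameters.
Context (R : realType) (alpha beta : R) (d : nat).

(** The exponent balances three errors: k^(-alpha) from the tail, k^beta / b from the bins, hence b
    = k^(alpha + beta), and sqrt(k b / n) from the union bound. Equality with k^(-alpha) forces n =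
    k^(3 alpha + beta + 1). *)
Definition rate_gamma : R := (3 * alpha + beta + 1)^-1.
Local Notation gamma := rate_gamma.

Definition rate_terms n := (Num.truncn (n%:R `^ gamma)).+1.
Definition rate_bins n := (Num.truncn (n%:R `^ (gamma * (alpha + beta)))).+1.
(** With a full logarithm rather than its square root, n t^2 is s (ln n)^2, which eventually exceeds
    any constant multiple of the log-cardinality bound s ln n. *)
Definition rate_tol n : R := n%:R `^ (- (alpha * gamma)) * ln n%:R.

Hypotheses (alpha0 : 0 < alpha) (beta0 : 0 < beta) (d0 : (0 < d)%N).

Lemma rate_gamma_gt0 : 0 < gamma.
Proof. by rewrite invr_gt0 !addr_gt0// mulr_gt0. Qed.

Lemma rate_gammaE : gamma * (3 * alpha + beta + 1) = 1.
Proof. by rewrite mulVf// gt_eqF// -invr_gt0; exact: rate_gamma_gt0. Qed.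

Lemma rate_terms_bounds n : (0 < n)%N ->
  n%:R `^ gamma <= (rate_terms n)%:R <= 2 * n%:R `^ gamma.
Proof.
by move=> n0; apply/truncnS_bounds/ge1_powR => //; exact/ltW/rate_gamma_gt0.
Qed.

Lemma rate_bins_bounds n : (0 < n)%N ->
  n%:R `^ (gamma * (alpha + beta)) <= (rate_bins n)%:R <=
  2 * n%:R `^ (gamma * (alpha + beta)).
Proof.
move=> n0; apply/truncnS_bounds/ge1_powR => //.
by rewrite mulr_ge0 ?addr_ge0 ?ltW// rate_gamma_gt0.
Qed.

Local Notation index n :=
  ('I_n.+1 + nl_code d (rate_terms n) (rate_bins n) (n ^ 2))%type.

(** With k <= 2 x, b + 1 <= 3 y and s = x y, a code has k + k d (b + 1) <= 8 d s entries, each with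
    n^2 + 1 <= n^3 values: exponent 24 d s ln n. The n + 1 other indices obey the same bound, and
    the resulting factor 2 is absorbed by 9 d s ln n. *)
Lemma card_rate_index n : (1 < n)%N ->
  #|{: index n}|%:R <= expR (33 * d%:R * n%:R `^ (gamma * (1 + alpha + beta)) *
    ln n%:R).
Proof.
move=> n1; have n0 : (0 < n)%N by exact: ltnW.
have n0' : 0 < n%:R :> R by rewrite ltr0n.
have g0 := rate_gamma_gt0.
set s := n%:R `^ (gamma * (1 + alpha + beta)).
have sE : s = n%:R `^ gamma * n%:R `^ (gamma * (alpha + beta)).
  rewrite -powRD; last by rewrite (gt_eqF n0') implybT.
  by congr (_ `^ _); ring.
have s1 : 1 <= s by apply: ge1_powR; rewrite // mulr_ge0 ?ltW// !addr_gt0.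
have d1 : 1 <= d%:R :> R by rewrite ler1n.
set e := (rate_terms n + rate_terms n * d * (rate_bins n).+1)%N.
have e_le : e%:R <= 8 * d%:R * s :> R.
  have /andP[_ h1] := rate_terms_bounds n0.
  have /andP[_ h2] := rate_bins_bounds n0.
  have b1 := ge1_powR n0 (mulr_ge0 (ltW g0) (addr_ge0 (ltW alpha0) (ltW beta0))).
  have k1 := ge1_powR n0 (ltW g0).
  rewrite /e natrD !natrM -[(rate_bins n).+1%:R]natr1.
  have k0 : 0 <= (rate_terms n)%:R :> R by [].
  have b0 : 0 <= (rate_bins n)%:R :> R by [].
  move: h1 h2 b1 k1 k0 b0; rewrite sE.
  move: (n%:R `^ gamma) (n%:R `^ (gamma * (alpha + beta))) (rate_terms n)%:R
    (rate_bins n)%:R d%:R d1.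
  move=> x y k b D D1 kx by' y1 x1 k0 b0.
  have h3 : k * (b + 1) <= 2 * x * (3 * y) by apply: ler_pM => //; lra.
  have h4 : D * (k * (b + 1)) <= D * (2 * x * (3 * y)) by rewrite ler_wpM2l//; lra.
  have h5 : x <= x * y by rewrite ler_peMr//; lra.
  have h6 : x * y <= D * (x * y) by rewrite ler_peMl// mulr_ge0//; lra.
  lra.
rewrite card_nl_index -/e.
have l0 : 0 <= ln n%:R :> R by rewrite ln_ge0// ler1n.
have nE : n%:R = expR (ln n%:R) :> R by rewrite lnK// posrE.
have n2 : (n ^ 2).+1%:R <= expR (3 * ln n%:R) :> R.
  rewrite mulrC expRM_natr -nE -natrX ler_nat.
  apply: (@leq_trans (2 * n ^ 2)).
    by rewrite mul2n -addnn -addn1 leq_add2l expn_gt0 n0.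
  by rewrite [leqRHS]expnS leq_pmul2r// expn_gt0 n0.
have ds1 : 1 <= d%:R * s by rewrite -[leLHS]mulr1; apply: ler_pM.
have dsl : ln n%:R <= d%:R * s * ln n%:R by rewrite ler_peMl.
have l24 : 3 * ln n%:R <= 24 * d%:R * s * ln n%:R by clear -dsl l0; lra.
have l9 : ln n%:R <= 9 * d%:R * s * ln n%:R by clear -dsl l0; lra.
have pow_le : ((n ^ 2).+1 ^ e)%:R <= expR (24 * d%:R * s * ln n%:R) :> R.
  rewrite natrX; apply: (@le_trans _ _ (expR (3 * ln n%:R) ^+ e)).
    by rewrite lerXn2r ?nnegrE ?expR_ge0.
  rewrite -expRM_natr ler_expR.
  have := ler_wpM2l (mulr_ge0 (ler0n R 3) l0) e_le; clear; lra.
have add_le : n.+1%:R <= expR (24 * d%:R * s * ln n%:R) :> R.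
  apply: (@le_trans _ _ (n ^ 2).+1%:R).
    by rewrite ler_nat ltnS -[leqLHS]expn1 leq_exp2l.
  by apply: le_trans n2 _; rewrite ler_expR.
have two_le : 2 <= expR (9 * d%:R * s * ln n%:R).
  apply: (@le_trans _ _ n%:R); first by rewrite ler_nat.
  by rewrite [leLHS]nE ler_expR.
rewrite natrD; apply: le_trans (lerD add_le pow_le) _.
rewrite -mulr2n -[leLHS]mulr_natl (_ : 33 * d%:R * s * ln n%:R =
  9 * d%:R * s * ln n%:R + 24 * d%:R * s * ln n%:R); last by ring.
by rewrite expRD ler_wpM2r// expR_ge0.
Qed.

Lemma near_union_bound : \forall n \near \oo,
  (#|{: index n}| ^ 2)%:R * (2 * expR (- (n%:R * rate_tol n ^+ 2 / 8))) <=
  n%:R^-1 :> R.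
Proof.
near=> n.
have n1 : (1 < n)%N by near: n; exact: nbhs_infty_gt.
have n0 : (0 < n)%N by exact: ltnW.
have n0' : 0 < n%:R :> R by rewrite ltr0n.
have g0 := rate_gamma_gt0.
set s := n%:R `^ (gamma * (1 + alpha + beta)).
(* The definition of gamma gives 1 - 2 alpha gamma = gamma (1 + alpha + beta). *)
have -> : n%:R * rate_tol n ^+ 2 = s * ln n%:R ^+ 2.
  rewrite /rate_tol exprMn mulrA; congr (_ * _).
  rewrite -[X in X * _](powRr1 (ltW n0')) expr2 -!powRD; last first.
  - by rewrite (gt_eqF n0') implybT.
  - by rewrite (gt_eqF n0') implybT.
  by congr (_ `^ _); have := rate_gammaE; lra.
have -> : n%:R^-1 = expR (- ln n%:R) :> R by rewrite expRN lnK// posrE.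
apply: (@union_bound_le R (33 * d%:R)).
- by rewrite mulr_ge0.
- by apply: ge1_powR; rewrite // mulr_ge0 ?ltW// !addr_gt0.
- by near: n; exact: near_ge_ln.
- exact: card_rate_index.
Unshelve. all: by end_near. Qed.

End RateParameters.

(** * Approximation error over an NL-class *)

Section Assembly.
Context (R : realType) (alpha beta : R) (d : nat).
Local Notation mu := (lebesgue_Rd R d).
Local Notation C := (@unit_cube R d).
Local Notation gamma := (rate_gamma alpha beta).
Local Notation terms := (rate_terms alpha beta).
Local Notation bins := (rate_bins alpha beta).
Local Notation tol := (rate_tol alpha beta).

Lemma bigO_bound (u e : R^nat) : u =O_\oo e ->
  exists2 K, 0 <= K & \forall k \near \oo, `|u k| <= K * `|e k|.
Proof.
move=> /eqOP uO; near (pinfty_nbhs R) => K; exists K.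
  by near: K; exact: nbhs_pinfty_ge.
by near: K; exact: uO.
Unshelve. all: by end_near. Qed.

(** [K] depends on the class through the constants of its O-bounds, whereas the family of codes does
    not; the constants only delay the [n] from which the bound holds. *)
Lemma NL_class_approx (p : Rd R d -> R) (W L : R^nat) :
  0 < alpha -> 0 < beta -> (0 < d)%N -> NL_bounds W L ->
  W =O_\oo (fun k => k.+1%:R `^ (- alpha)) ->
  L =O_\oo (fun k => k.+1%:R `^ beta) ->
  cube_pdf p -> NL_class W L p ->
  exists2 K, 0 <= K & \forall n \near \oo,
    exists c : nl_code d (terms n) (bins n) (n ^ 2),
      dist1 mu setT (cube_density (nl_fun n c)) p <= K * n%:R `^ (- (alpha * gamma)).
Proof.
move=> alpha0 beta0 d0 [W0 _ _ L0 ndL] /bigO_bound[C1 C10 WC] /bigO_bound[C2 C20 LC].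
move=> cubep [_ [w [l [[w0 sumw _ [q [qpdf qlip paE]]] lL tailW]]]].
have g0 := rate_gamma_gt0 alpha0 beta0; have gE := rate_gammaE alpha0 beta0.
have ag0 : 0 < alpha * gamma by exact: mulr_gt0.
have bg0 : 0 < gamma * beta by exact: mulr_gt0.
have [N1 _ WN] := WC; have [N2 _ LN] := LC.
(* The number of terms is at most 2 n^gamma, whence the factor 2^beta in the bound on L. *)
pose A := C2 * 2 `^ beta; have A0 : 0 <= A by rewrite mulr_ge0 ?powR_ge0.
(* The outer 2 comes from normalization; inside, C1 bounds the tail, d (A + 1) the step functions,
   and 2 the rounding of the weights. *)
exists (2 * (2 ^+ d * (C1 + d%:R * (A + 1) + 2))).
  by rewrite !mulr_ge0 ?exprn_ge0// !addr_ge0// mulr_ge0// addr_ge0.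
near=> n.
have n1 : (1 < n)%N by near: n; exact: nbhs_infty_gt.
have n0 : (0 < n)%N by exact: ltnW.
have n0' : 0 < n%:R :> R by rewrite ltr0n.
have n1' : 1 <= n%:R :> R by rewrite ler1n.
have nn0 : n%:R != 0 :> R by rewrite gt_eqF.
set r := n%:R `^ (- (alpha * gamma)).
have r0 : 0 < r by exact: powR_gt0.
have /andP[k1 k2] := rate_terms_bounds alpha0 beta0 n0.
have /andP[b1 b2] := rate_bins_bounds alpha0 beta0 n0.
(* With indices starting at 0, entry k' of [W] bounds the tail after the first k' + 1 terms, and the
   O-bounds at k' involve powers of k' + 1. *)
have [k' kE] : exists k', terms n = k'.+1 by exists (terms n).-1.
have kN : (maxn N1 N2 < terms n)%N.
  rewrite -(ltr_nat R); apply: lt_le_trans k1.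
  apply: lt_le_trans (_ : (maxn N1 N2)%:R + 1 <= _); first by rewrite ltrDl.
  by near: n; exact: near_ge_powR.
have Wk : W k' <= C1 * r.
  have := WN k'; rewrite /= -ltnS -kE (leq_ltn_trans (leq_maxl _ _) kN) => /(_ isT).
  rewrite ger0_norm// => /le_trans; apply; rewrite ler_wpM2l//.
  rewrite ger0_norm ?powR_ge0// /r !powRN lef_pV2 ?posrE ?powR_gt0 ?ltr0n//.
  rewrite mulrC powRrM; apply: ge0_ler_powR; rewrite ?nnegrE ?powR_ge0//.
  exact: ltW.
have Lk : L k' <= A * n%:R `^ (gamma * beta).
  have := LN k'; rewrite /= -ltnS -kE (leq_ltn_trans (leq_maxr _ _) kN) => /(_ isT).
  rewrite ger0_norm// => /le_trans; apply; rewrite /A -mulrA ler_wpM2l//.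
  rewrite ger0_norm ?powR_ge0// powRrM -powRM ?powR_ge0//.
  by apply: ge0_ler_powR; rewrite ?nnegrE ?mulr_ge0 ?powR_ge0// ltW.
have eta_le : A * n%:R `^ (gamma * beta) / (bins n)%:R + n%:R^-1 <= (A + 1) * r.
  rewrite mulrDl mul1r lerD//.
    rewrite -mulrA ler_wpM2l// ler_pdivrMr ?ltr0n//.
    apply: (@le_trans _ _ (r * n%:R `^ (gamma * (alpha + beta)))).
      rewrite -powRD ?nn0 ?implybT//.
      by rewrite (_ : _ + _ = gamma * beta)//; ring.
    by rewrite ler_wpM2l// ltW.
  by rewrite -(powR_inv1 (ltW n0')); apply: ler_powR => //; lra.
have k_n : (terms n)%:R / n%:R <= 2 * r.
  rewrite ler_pdivrMr//; apply: le_trans k2 _; rewrite -mulrA ler_wpM2l//.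
  rewrite -[X in _ * X](powRr1 (ltW n0')) -powRD ?nn0 ?implybT//.
  by apply: ler_powR => //; lra.
have [c cp] : exists c : nl_code d (terms n) (bins n) (n ^ 2),
    dist1 mu C (nl_fun n c) p <= 2 ^+ d * (W k' + d%:R *
      (A * n%:R `^ (gamma * beta) / (bins n)%:R + n%:R^-1) + (terms n)%:R / n%:R).
  apply: (@nl_family_approx R d n (terms n) (bins n) (n ^ 2) p w l q) => //.
  - move=> i; rewrite kE ltnS => ik; apply: le_trans (lL i) _.
    by apply: le_trans Lk; exact: ndL.
  - by rewrite mulr_ge0// powR_ge0.
  - rewrite natrX expr2 ler_pM2l//.
    have gb1 : 1 <= n%:R `^ (gamma * beta) by apply: ge1_powR => //; exact: ltW.
    (* Since gamma beta < 1, the numerators n (1 + A n^(gamma beta)) eventually fit below n^2. *)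
    have nA : 1 + A <= n%:R `^ (1 - gamma * beta).
      by near: n; apply: near_ge_powR; lra.
    apply: (@le_trans _ _ ((1 + A) * n%:R `^ (gamma * beta))).
      by rewrite mulrDl mul1r lerD2r.
    apply: le_trans (ler_wpM2r (powR_ge0 _ _) nA) _.
    by rewrite -powRD ?nn0 ?implybT// subrK powRr1// ltW.
  - apply: le_trans eta_le _; rewrite mulrC -ler_pdivlMr ?ltr_wpDl// div1r.
    by rewrite /r; near: n; apply: near_powRN_le => //; rewrite invr_gt0 ltr_wpDl.
  - by rewrite kE; exact: tailW.
have h := dist1_cube_density cubep (integrable_nl_fun R n c).
exists c; apply: (le_trans h).
rewrite -[leRHS]mulrA ler_wpM2l//; apply: le_trans cp _.
rewrite -[leRHS]mulrA ler_wpM2l ?exprn_ge0//.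
rewrite [leRHS]mulrDl [X in _ <= X + _]mulrDl; apply: lerD => //; apply: lerD => //.
by rewrite -[leRHS]mulrA; apply: ler_wpM2l.
Unshelve. all: by end_near. Qed.

End Assembly.

(** * Consistency and rate of the minimum-distance estimator *)

Theorem proposition6 (R : realType) (alpha beta : R) (d : nat)
    (alpha_gt0 : 0 < alpha) (beta_gt0 : 0 < beta) (d_gt0 : (0 < d)%N) :
  exists V : forall n : nat, n.-tuple (Rd R d) -> Rd R d -> R,
    [/\ forall n, is_estimator (V n),
        forall p : Rd R d -> R, cube_pdf p ->
          forall (disp : measure_display) (Omega : measurableType disp)
            (P : probability Omega R) (X : nat -> {RV P >-> Rd R d}),
          iid_with_density X p ->
          forall eps : R, 0 < eps ->
            P [set omega | (eps%:E < L1_dist p (V n (sample X n omega)))%E]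
              @[n --> \oo] --> 0%E
      & forall W L : R^nat, NL_bounds W L ->
          W =O_\oo (fun k => k.+1%:R `^ (- alpha)) ->
          L =O_\oo (fun k => k.+1%:R `^ beta) ->
          forall p : Rd R d -> R, cube_pdf p -> NL_class W L p ->
          exists C c : R, [/\ 0 <= C, 0 <= c &
            forall (disp : measure_display) (Omega : measurableType disp)
              (P : probability Omega R) (X : nat -> {RV P >-> Rd R d}),
            iid_with_density X p ->
            P [set omega | (L1_dist (V n (sample X n omega)) p <=
                (C * n%:R `^ (- (alpha / (3 * alpha + beta + 1)))
                   * (ln n%:R) `^ c)%:E)%E]
              @[n --> \oo] --> 1%E]].
Proof.
have [g [gpdf gdense]] := countable_dense_densities R d.
pose index n := ('I_n.+1 + nl_code d (rate_terms alpha beta n)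
  (rate_bins alpha beta n) (n ^ 2))%type.
pose f n (i : index n) : Rd R d -> R :=
  match i with inl j => g j | inr c => cube_density (nl_fun n c) end.
have fpdf n i : cube_pdf (@f n i).
  case: i => [j|c] /=; first exact: gpdf.
  apply: cube_density_pdf; first exact: measurable_nl_fun.
  exact: integrable_nl_fun.
pose V n := sval (cid (yatracos_estimator (inl ord0 : index n) n (@fpdf n))).
have inv_cvg0 : (n%:R^-1%:E : \bar R) @[n --> \oo] --> 0%E.
  apply: cvg_EFin; first exact: nearW.
  apply/cvgrPdist_le => e e0; near=> n.
  rewrite sub0r normrN ger0_norm ?invr_ge0// invf_ple ?posrE//; last first.
    by rewrite ltr0n; near: n; exact: nbhs_infty_gt.
  by apply/ltW; near: n; exact: nbhs_infty_gtr.
have ag0 : 0 < alpha * rate_gamma alpha beta.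
  by rewrite mulr_gt0// rate_gamma_gt0.
pose tol n := rate_tol alpha beta n.
(* The index is quantified inside [near], because the member compared with may vary with n: a fixed
   term of the dense sequence for consistency, a code depending on n for the rate. *)
have deviation p disp (Omega : measurableType disp) (P : probability Omega R)
    (X : nat -> {RV P >-> Rd R d}) : cube_pdf p -> iid_with_density X p ->
    \forall n \near \oo, forall (i : index n) (x : R),
      5 * dist1 (lebesgue_Rd R d) setT (f n i) p + 4 * tol n <= x ->
      (P [set w | ~ (L1_dist (V n (sample X n w)) p <= x%:E)%E] <= n%:R^-1%:E)%E.
  move=> cubep iidX; near=> n => i x ix.
  have n1 : (1 < n)%N by near: n; exact: nbhs_infty_gt.
  have := svalP (cid (yatracos_estimator (inl ord0 : index n) n (@fpdf n))).
  rewrite -/(V n) => -[_ /(_ p cubep disp Omega P X iidX)[mQ dev]].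
  have tol0 : 0 < tol n.
    by rewrite mulr_gt0 ?powR_gt0 ?ln_gt0 ?ltr1n// ltr0n ltnW.
  have tol2 : tol n <= 2 by near: n; exact: near_powRN_ln_le.
  have intf := is_pdf_integrable (proj1 (fpdf n i)).
  have intp := is_pdf_integrable (proj1 cubep).
  apply: (@le_trans _ _ (P [set w | ~ (L1_dist (V n (sample X n w)) p <=
      5%:E * L1_dist (f n i) p + (4 * tol n)%:E)%E])).
    apply: le_measure; rewrite ?inE.
    - exact: (mQ (fun y => ~ (y <= x%:E)%E)).
    - exact: (mQ (fun y => ~ (y <= 5%:E * L1_dist (f n i) p + (4 * tol n)%:E)%E)).
    move=> w /=; apply: contra_not => /le_trans; apply.
    by rewrite L1_distE// -EFinM -EFinD lee_fin.
  apply: le_trans (dev (tol n) i (ltnW n1) tol0 tol2) _.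
  by rewrite lee_fin; near: n; exact: near_union_bound.
have mV n disp (Omega : measurableType disp) (P : probability Omega R)
    (X : nat -> {RV P >-> Rd R d}) p Q : cube_pdf p -> iid_with_density X p ->
    measurable [set w | Q (L1_dist (V n (sample X n w)) p)].
  move=> cubep iidX.
  have := svalP (cid (yatracos_estimator (inl ord0 : index n) n (@fpdf n))).
  by rewrite -/(V n) => -[_ /(_ p cubep disp Omega P X iidX)[mQ _]]; exact: mQ.
have estV n : is_estimator (V n).
  by case: (svalP (cid (yatracos_estimator (inl ord0 : index n) n (@fpdf n)))).
have VC n p s : cube_pdf p -> L1_dist p (V n s) = L1_dist (V n s) p.
  move=> [ppdf _]; have [_ /(_ s)[Vpdf _]] := estV n.
  by rewrite !L1_distE; [rewrite dist1C|exact: is_pdf_integrable..].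
exists V; split=> [n|p cubep disp Omega P X iidX eps eps0|W L WL WO LO p cubep pNL].
- exact: estV.
(* The risk bound becomes 5 eps/10 + 4 eps/8 = eps. *)
- have eps10 : 0 < eps / 10 by rewrite divr_gt0.
  have [i gi] := gdense p cubep _ eps10.
  apply: (squeeze_cvge _ (cvg_cst 0%E) inv_cvg0).
  near=> n; rewrite measure_ge0/=.
  rewrite (_ : [set w | _] = [set w | ~ (L1_dist (V n (sample X n w)) p <=
    eps%:E)%E]).
    (* The approximating term of the dense sequence belongs to the family once n >= i. *)
    have ni : (i < n.+1)%N by near: n; exact: nbhs_infty_ge.
    have tol_eps : tol n <= eps / 8 by near: n; apply: near_powRN_ln_le => //; lra.
    have dev : forall (j : index n) (x : R),
        5 * dist1 (lebesgue_Rd R d) setT (f n j) p + 4 * tol n <= x ->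
        (P [set w | ~ (L1_dist (V n (sample X n w)) p <= x%:E)%E] <= n%:R^-1%:E)%E.
      by near: n; exact: deviation.
    apply: (dev (inl (Ordinal ni))) => /=; lra.
  by apply/seteqP; split => w /=; rewrite VC// ltNge => /negP.
have [K K0 pK] := NL_class_approx alpha_gt0 beta_gt0 d_gt0 WL WO LO cubep pNL.
(* The constant is that of the risk bound 5 |f - p|_1 + 4 t; the approximation term has no logarithm
   and gets one as soon as ln n >= 1. *)
exists (5 * K + 4), 1; split => // [|disp Omega P X iidX].
  by rewrite addr_ge0// mulr_ge0.
have one_cvg : (1 - n%:R^-1%:E : \bar R)%E @[n --> \oo] --> 1%E.
  rewrite -[X in _ --> X]sube0; apply: cvgeB => //; exact: cvg_cst.
apply: (squeeze_cvge _ one_cvg (cvg_cst 1%E)).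
near=> n; set good := [set w | _].
have mgood : measurable good.
  exact: (mV n _ _ _ X p (fun y => (y <= (_)%:E)%E)).
rewrite probability_le1// andbT -(setCK good) probability_setC; last exact:
  measurableC.
apply: leeB => //.
have [i ip] : exists c : nl_code d (rate_terms alpha beta n) (rate_bins alpha
  beta n) (n ^ 2),
    dist1 (lebesgue_Rd R d) setT (cube_density (nl_fun n c)) p <=
    K * n%:R `^ (- (alpha * rate_gamma alpha beta)) by near: n; exact: pK.
have ln1 : 1 <= ln n%:R :> R by near: n; exact: near_ge_ln.
have dev : forall (j : index n) (x : R),
    5 * dist1 (lebesgue_Rd R d) setT (f n j) p + 4 * tol n <= x ->
    (P [set w | ~ (L1_dist (V n (sample X n w)) p <= x%:E)%E] <= n%:R^-1%:E)%E.
  by near: n; exact: deviation.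
apply: (dev (inr i)) => /=.
rewrite powRr1; last by apply: le_trans ln1.
rewrite /tol /rate_tol -/(alpha / _).
set r := n%:R `^ _ in ip *; have r0 : 0 <= r by exact: powR_ge0.
have Krl : K * r <= K * r * ln n%:R by rewrite ler_peMr// mulr_ge0.
nra.
Unshelve. all: by end_near. Qed.
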